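(* For every $k\ge1$ there are constants $c_1,c_2>0$ such that the following holds. For every $n\ge 2k$ and every family $\mathcal F$ of weighted $k$-uniform hypergraphs with vertex set $[n]$ such that $w([n])=0$ for all $w\in\mathcal F$, there is a partition $\mathcal F=\mathcal F_1\cup\cdots\cup\mathcal F_k$ (parts possibly empty) such that, for every $1\le i\le k$ and all distinct $w,u\in \mathcal F_i$, $$\operatorname{disc}(w,u) \ge c_1 \|w\|_1\|u\|_1/n^{i/2-1/2+k}$$ and $$\mathbb{E}_\pi|\langle w_\pi,u\rangle|\ge c_2\|w\|_1\|u\|_1/n^{i/2+k},$$ where $\pi$ is a uniformly random permutation of $[n]$.
   Context: $[n]=\{1,\dots,n\}$; $V^{(k)}$ is the family of $k$-subsets of $V$. A weighted $k$-uniform hypergraph on $V$ is a function $w:V^{(k)}\to\mathbb{R}$; $w(S)=\sum_{e\in S^{(k)}}w(e)$, $\|w\|_1=\sum_e|w(e)|$, $\langle w,u\rangle=\sum_{e}w(e)u(e)$, $d(w)=w(V)/\binom{|V|}k$, and $w_\pi(e)=w(\pi^{-1}(e))$ for a permutation $\pi$ of $V$. With $n=|V|$, $\operatorname{disc}(w,u)=\max_\pi|\langle w_\pi,u\rangle-d(w)d(u)\binom nk|$ over all permutations $\pi$ of $V$. *)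

(* Defs.v *)
From HB Require Import structures.
From mathcomp Require Import all_boot all_order all_algebra all_fingroup.
From mathcomp Require Import reals.
Set Implicit Arguments. Unset Strict Implicit. Unset Printing Implicit Defensive.
Import Order.TTheory GRing.Theory Num.Theory.
Local Open Scope ring_scope.

Section Hyper.
Variables (R : realType) (n k : nat).

(* A weighted k-uniform hypergraph on [n] ~ 'I_n is a function on k-subsets.
   We represent it as a function on all subsets that vanishes off k-subsets. *)
Definition is_kgraph (w : {set 'I_n} -> R) : Prop :=
  forall e : {set 'I_n}, #|e| != k -> w e = 0.

Definition wsum (w : {set 'I_n} -> R) (S : {set 'I_n}) : R :=
  \sum_(e : {set 'I_n} | (e \subset S) && (#|e| == k)) w e.

Definition hnorm1 (w : {set 'I_n} -> R) : R :=
  \sum_(e : {set 'I_n} | #|e| == k) `|w e|.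

Definition dotp (w u : {set 'I_n} -> R) : R :=
  \sum_(e : {set 'I_n} | #|e| == k) w e * u e.

Definition dens (w : {set 'I_n} -> R) : R :=
  wsum w [set: 'I_n] / ('C(n, k))%:R.

Definition wperm (pi : {perm 'I_n}) (w : {set 'I_n} -> R) : {set 'I_n} -> R :=
  fun e => w ((pi^-1)%g @: e).

Definition disc (w u : {set 'I_n} -> R) : R :=
  \big[Order.max/0]_(pi : {perm 'I_n})
     `|dotp (wperm pi w) u - dens w * dens u * ('C(n, k))%:R|.

Definition exp_abs_dot (w u : {set 'I_n} -> R) : R :=
  (n`!)%:R^-1 * \sum_(pi : {perm 'I_n}) `|dotp (wperm pi w) u|.

End Hyper.

(* Main.v *)
(* For a list q of i disjoint pairs (x_l, y_l) of vertices put
   sigma_q(e) = prod_l ([x_l in e] - [y_l in e]) and let D_i(w) be the mean over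
   permutations of |<w_pi, sigma_q>|; it does not depend on q.  Replacing the factors
   [x_l in e] of the indicator of a k-set by differences one at a time gives
   |w|_1 <= C sum_(i <= k) n^i D_i(w).  The term i = 0 vanishes as w([n]) = 0, so some
   i >= 1 has n^i D_i(w) >= c |w|_1; put w in F_i.
   For w, u in F_i take i blocks of a ~ n/(2k) disjoint pairs.  As a function of the
   flips of the pairs of one block, pi |-> <w_pi, u> is a multilinear polynomial of
   degree at most k.  Testing it against prod_v (1 + z s_v eps_v) for real z in [0,1],
   resp. imaginary z of size a^(-1/2), and extracting the linear coefficient in z,
   shows that the sum of the absolute values of its linear coefficients is at most C
   times its maximum, resp. C sqrt a times its mean absolute value.  A linear
   coefficient is <w_pi, u'> with u' antisymmetric under one pair, so this can be
   iterated over the blocks.  After i blocks, averaging over the permutations that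
   preserve sigma_q up to sign turns u' into a multiple of sigma_q, and the overlap
   factors as <u, sigma_q> <w_pi, sigma_q> / O(n^(k-i)).  Summing over the a^i choices
   of q gives a^(i/2) D_i(w) D_i(u) / n^(k-i) for the mean, and a further factor
   sqrt a for the maximum. *)
Require Import Defs.
From HB Require Import structures.
From mathcomp Require Import all_boot all_order all_algebra all_fingroup.
From mathcomp Require Import boolp reals complex.
From mathcomp Require Import zify ring lra.
Import Order.TTheory GRing.Theory Num.Theory.
Local Open Scope ring_scope.
Set Implicit Arguments. Unset Strict Implicit. Unset Printing Implicit Defensive.

(** * Vertex lists of pairs, and permutations acting on sets *)

Definition flat (T : Type) (q : seq (T * T)) : seq T :=
  flatten [seq [:: p.1; p.2] | p <- q].

Lemma flat_cons (T : Type) p (q : seq (T * T)) :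
  flat (p :: q) = [:: p.1, p.2 & flat q].
Proof. by []. Qed.

Lemma flat_cat (T : Type) (q r : seq (T * T)) : flat (q ++ r) = flat q ++ flat r.
Proof. by rewrite /flat map_cat flatten_cat. Qed.

Lemma size_flat (T : Type) (q : seq (T * T)) : size (flat q) = (size q).*2.
Proof. by elim: q => // p q IH; rewrite flat_cons /= IH. Qed.

Lemma perm_flat (T : eqType) (q r : seq (T * T)) :
  perm_eq q r -> perm_eq (flat q) (flat r).
Proof. by move=> h; apply: perm_flatten; apply: perm_map. Qed.

Lemma mem_flat (T : eqType) (q : seq (T * T)) p :
  p \in q -> (p.1 \in flat q) && (p.2 \in flat q).
Proof.
elim: q => // r q IH; rewrite flat_cons inE => /orP[/eqP-> | /IH /andP[h1 h2]].
  by rewrite !inE !eqxx !orbT.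
by rewrite !inE h1 h2 !orbT.
Qed.

Lemma flatP (T : eqType) (q : seq (T * T)) x :
  x \in flat q -> exists2 p, p \in q & (x == p.1) || (x == p.2).
Proof.
move=> /flattenP [l /mapP [p pq ->]]; rewrite !inE => h.
by exists p.
Qed.

Lemma flat_surj (T : Type) (m : nat) (s : seq T) :
  size s = m.*2 -> exists2 q, size q = m & flat q = s.
Proof.
elim: m s => [|m IH] s; first by move/size0nil->; exists [::].
case: s => [|x [|y s]] //= [] /IH [q qm qs].
by exists ((x, y) :: q); rewrite ?flat_cons /= ?qm ?qs.
Qed.

Lemma perm_of_uniq (T : finType) (s t : seq T) :
  uniq s -> uniq t -> size s = size t -> exists f : {perm T}, map f s = t.
Proof.
elim: s t => [|x s IH] [|y t] //=; first by exists 1%g.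
move=> /andP[xs us] /andP[yt ut] [st].
have [f ft] := IH t us ut st.
exists (f * tperm (f x) y)%g; rewrite permM tpermL; congr (_ :: _).
rewrite -[RHS]ft; apply/eq_in_map => z zs; rewrite permM tpermD //.
  by apply: contra xs => /eqP /perm_inj ->.
by apply: contra yt => /eqP ->; rewrite -ft map_f.
Qed.

Lemma mem_imset_perm (T : finType) (f : {perm T}) (e : {set T}) x :
  (x \in f @: e) = ((f^-1)%g x \in e).
Proof. by rewrite -{1}(permKV f x) mem_imset //; apply: perm_inj. Qed.

Lemma imset_permM (T : finType) (f g : {perm T}) (e : {set T}) :
  (f * g)%g @: e = g @: (f @: e).
Proof. by rewrite -imset_comp; apply: eq_imset => x; rewrite permM. Qed.

Lemma card_imset_perm (T : finType) (f : {perm T}) (e : {set T}) :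
  #|f @: e| = #|e|.
Proof. by rewrite card_imset //; apply: perm_inj. Qed.

Lemma imset_perm1 (T : finType) (e : {set T}) : (1%g : {perm T}) @: e = e.
Proof. by apply/setP=> x; rewrite mem_imset_perm invg1 perm1. Qed.

Lemma reindex_ksets (R : nmodType) (T : finType) (k : nat) (f : {perm T})
    (H : {set T} -> R) :
  \sum_(e : {set T} | #|e| == k) H (f @: e) = \sum_(e : {set T} | #|e| == k) H e.
Proof.
rewrite [RHS](reindex_inj (imset_inj (@perm_inj _ f))) /=.
by apply: eq_bigl => e; rewrite card_imset_perm.
Qed.

Lemma sum_perm_mulgl (R : nmodType) (T : finType) (g : {perm T}) (H : {perm T} -> R) :
  \sum_f H (g * f)%g = \sum_f H f.
Proof. by rewrite [RHS](reindex_inj (mulgI g)). Qed.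

Lemma bin_le_expn (m k : nat) : ('C(m, k) <= m ^ k)%N.
Proof.
apply: (@leq_trans ('C(m, k) * k`!)); first by rewrite leq_pmulr // fact_gt0.
rewrite bin_ffact ffact_prod -[X in (_ <= _ ^ X)%N](card_ord k) -prod_nat_const.
by apply: leq_prod => i _; apply: leq_subr.
Qed.

(** * Overlaps, signed incidence functions and the choice of a level *)

Section Pairing.
Variables (R : realType) (n k : nat).
Implicit Types (w u : {set 'I_n} -> R) (e : {set 'I_n}).
Implicit Types (q : seq ('I_n * 'I_n)) (t : seq 'I_n).

(** This is the inner product of [u] with [w] permuted by [f^-1]. As [f] runs over the whole group,
    [overlap_norm] is n! times the mean of |<w_pi, u>|. *)
Definition overlap w u (f : {perm 'I_n}) : R :=
  \sum_(e : {set 'I_n} | #|e| == k) u e * w (f @: e).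

Definition overlap_norm w u : R := \sum_(f : {perm 'I_n}) `|overlap w u f|.

Definition translate u (f : {perm 'I_n}) : {set 'I_n} -> R := fun e => u (f @: e).

Lemma overlap_norm_ge0 w u : 0 <= overlap_norm w u.
Proof. by apply: sumr_ge0 => f _. Qed.

Lemma overlap_translate w u g f : overlap w (translate u g) f = overlap w u (g^-1 * f)%g.
Proof.
rewrite /overlap -[RHS](reindex_ksets k g); apply: eq_bigr => e _.
by rewrite imset_permM -!imset_permM mulgA mulgV mul1g.
Qed.

Lemma overlap_norm_translate w u g : overlap_norm w (translate u g) = overlap_norm w u.
Proof.
rewrite /overlap_norm -[RHS](sum_perm_mulgl g^-1%g).
by apply: eq_bigr => f _; rewrite overlap_translate.
Qed.

Lemma eq_overlap w u v f : (forall e, #|e| = k -> u e = v e) -> overlap w u f = overlap w v f.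
Proof. by move=> h; apply: eq_bigr => e /eqP /h ->. Qed.

(* Summing w against pair_sign q isolates the component of w in degree size q:
   it is the alternating sum of degrees over the transversals of the pairs in q. *)
Definition pair_sign q e : R := \prod_(p <- q) ((p.1 \in e)%:R - (p.2 \in e)%:R).

(** Interpolates between [pair_sign q], at empty [t], and, on k-sets, the indicator of a single
    k-set, at empty [q] and k distinct vertices in [t]. *)
Definition mixed_sign q t e : R := pair_sign q e * \prod_(x <- t) (x \in e)%:R.

Lemma overlap_norm_mixed_sign0 w q :
  overlap_norm w (mixed_sign q [::]) = overlap_norm w (pair_sign q).
Proof.
apply: eq_bigr => f _; congr `|_|; apply: eq_overlap => e _.
by rewrite /mixed_sign big_nil mulr1.
Qed.

Lemma mixed_sign_map (f : {perm 'I_n}) q t e :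
  mixed_sign [seq (f p.1, f p.2) | p <- q] (map f t) (f @: e) = mixed_sign q t e.
Proof.
rewrite /mixed_sign /pair_sign !big_map; congr (_ * _); apply: eq_bigr => p _ /=;
by rewrite !mem_imset_perm !permK.
Qed.

(** A permutation carries one list of distinct vertices to the other, and translating [u] leaves
    [overlap_norm] unchanged. So only the numbers of pairs and of single vertices matter. *)
Lemma overlap_norm_mixed_sign_uniq (q r : seq ('I_n * 'I_n)) t s w :
  uniq (flat q ++ t) -> uniq (flat r ++ s) -> size q = size r -> size t = size s ->
  overlap_norm w (mixed_sign q t) = overlap_norm w (mixed_sign r s).
Proof.
move=> uq ur qr ts.
have sz : size (flat q ++ t) = size (flat r ++ s).
  by rewrite !size_cat !size_flat qr ts.
have [f hf] := perm_of_uniq uq ur sz; have hs: size (map f (flat q)) = size (flat r).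
  by rewrite size_map !size_flat qr.
move: hf; rewrite map_cat => /eqP; rewrite eqseq_cat // => /andP[/eqP hq /eqP ht].
have {}hq : [seq (f p.1, f p.2) | p <- q] = r.
  elim: q r qr hq {uq ur hs sz} => [|p q IH] [|p' r] //= [qr] [h1 h2 h3].
  by rewrite h1 h2 (IH r) //; case: (p').
rewrite -(overlap_norm_translate w (mixed_sign r s) f); apply: eq_bigr => g _; congr `|_|.
by apply: eq_overlap => e _; rewrite /translate -hq -ht mixed_sign_map.
Qed.

Lemma mixed_sign_neq0 q t e : mixed_sign q t e != 0 ->
  count (mem e) (flat q) = size q /\ count (mem e) t = size t.
Proof.
rewrite mulf_eq0 negb_or => /andP[hq ht]; split.
  elim: q hq => //= p q IH; rewrite /pair_sign big_cons mulf_eq0 negb_or.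
  move=> /andP[hp /IH ->].
  by move: hp; case: (p.1 \in e); case: (p.2 \in e); rewrite ?subrr ?eqxx.
elim: t ht => //= x t IH; rewrite big_cons mulf_eq0 negb_or.
by move=> /andP[hx /IH ->]; move: hx; case: (x \in e); rewrite // eqxx.
Qed.

Lemma sum_notin (Z : seq 'I_n) e : uniq Z ->
  \sum_(y | y \notin Z) (y \in e)%:R = #|e|%:R - (count (mem e) Z)%:R :> R.
Proof.
move=> uZ; apply/eqP; rewrite eq_sym subr_eq; apply/eqP.
have -> : #|e|%:R = \sum_(y : 'I_n) (y \in e)%:R :> R.
  by rewrite -sum1_card natr_sum big_mkcond; apply: eq_bigr => y _; case: (y \in e).
rewrite (bigID (mem Z)) /= addrC; congr (_ + _).
rewrite -big_uniq //=; elim: (Z) => [|z s IH] /=; first by rewrite big_nil.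
by rewrite big_cons IH natrD.
Qed.

Lemma card_notin (Z : seq 'I_n) : uniq Z ->
  #|[pred y | y \notin Z]| = (n - size Z)%N.
Proof.
move=> uZ; have := cardC (mem Z); rewrite card_ord (card_uniqP uZ) => h.
suff : (size Z + #|[pred y | y \notin Z]| = n)%N by lia.
by rewrite -[RHS]h; congr (_ + _)%N; apply: eq_card.
Qed.

(* Where mixed_sign q t is nonzero, e meets flat q ++ t in exactly
   size q + size t points, so the sum over y only depends on x \in e. *)
Lemma mixed_sign_recurrence q x t e : #|e| = k -> uniq (flat q ++ x :: t) ->
  (n%:R - (size q).*2%:R - (size t)%:R) * mixed_sign q (x :: t) e =
  \sum_(y | y \notin flat q ++ x :: t) mixed_sign ((x, y) :: q) t e
    + (k%:R - (size q)%:R - (size t)%:R) * mixed_sign q t e.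
Proof.
move=> ek uZ.
have kx : mixed_sign q (x :: t) e = (x \in e)%:R * mixed_sign q t e.
  by rewrite /mixed_sign big_cons; ring.
have ky y : mixed_sign ((x, y) :: q) t e = ((x \in e)%:R - (y \in e)%:R) * mixed_sign q t e.
  by rewrite /mixed_sign /pair_sign big_cons; ring.
rewrite kx (eq_bigr _ (fun y _ => ky y)) -mulr_suml.
have [-> | nz] := eqVneq (mixed_sign q t e) 0; first by rewrite !mulr0 addr0.
have [hq ht] := mixed_sign_neq0 nz.
rewrite sumrB (sum_notin e uZ) ek count_cat /= hq ht.
have -> : \sum_(y | y \notin flat q ++ x :: t) (x \in e)%:R
   = (n%:R - (size q).*2%:R - (size t).+1%:R) * (x \in e)%:R :> R.
  rewrite sumr_const -[LHS]mulr_natl; congr (_ * _).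
  have := cardC (mem (flat q ++ x :: t)); rewrite card_ord (card_uniqP uZ).
  rewrite size_cat size_flat /= => /(congr1 (fun m => m%:R : R)).
  rewrite !natrD => <-.
  transitivity (#|[predC flat q ++ x :: t]|%:R : R); last by ring.
  by congr (_%:R); apply: eq_card.
by rewrite !natrD; case: (x \in e) => /=; ring.
Qed.

Lemma overlapZ w (c : R) u f : overlap w (fun e => c * u e) f = c * overlap w u f.
Proof. by rewrite /overlap mulr_sumr; apply: eq_bigr => e _; rewrite mulrA. Qed.

Lemma overlapD w u v f : overlap w (fun e => u e + v e) f = overlap w u f + overlap w v f.
Proof. by rewrite /overlap -big_split; apply: eq_bigr => e _; rewrite mulrDl. Qed.

Lemma overlap_sum (I : Type) (r : seq I) (P : pred I) w (u : I -> {set 'I_n} -> R) f :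
  overlap w (fun e => \sum_(i <- r | P i) u i e) f = \sum_(i <- r | P i) overlap w (u i) f.
Proof.
by rewrite /overlap exchange_big; apply: eq_bigr => e _; rewrite mulr_suml.
Qed.

(** Triangle inequality in [mixed_sign_recurrence]; the size conditions make both coefficients
    nonnegative. *)
Lemma overlap_norm_recurrence w q x t : uniq (flat q ++ x :: t) ->
  (size q + size t < k)%N -> (2 * k <= n)%N ->
  (n%:R - (size q).*2%:R - (size t)%:R) * overlap_norm w (mixed_sign q (x :: t)) <=
  \sum_(y | y \notin flat q ++ x :: t) overlap_norm w (mixed_sign ((x, y) :: q) t)
    + (k%:R - (size q)%:R - (size t)%:R) * overlap_norm w (mixed_sign q t).
Proof.
move=> uZ qt kn.
have D0 : 0 <= n%:R - (size q).*2%:R - (size t)%:R :> R.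
  by rewrite -addrA -opprD -natrD subr_ge0 ler_nat; lia.
have D1 : 0 <= k%:R - (size q)%:R - (size t)%:R :> R.
  by rewrite -addrA -opprD -natrD subr_ge0 ler_nat; lia.
rewrite /overlap_norm exchange_big !mulr_sumr -big_split /=.
apply: ler_sum => f _; rewrite -{1}(ger0_norm D0) -normrM -overlapZ.
rewrite (eq_overlap w f (fun e ek => mixed_sign_recurrence ek uZ)) overlapD overlap_sum overlapZ.
apply: le_trans (ler_normD _ _) _; apply: lerD; first exact: ler_norm_sum.
by rewrite normrM (ger0_norm D1).
Qed.

(** Induction on [t]: the recurrence turns a vertex into a pair, or drops it, and then the missing
    power of n is made up by the divisor [D]. A vertex weighs two factors [1 + k%:R ^+ 2] and a pair
    one, so each step frees one factor, which pays for both terms. *)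
Lemma overlap_norm_mixed_sign_le w (d : R) : (2 * k <= n)%N -> 0 <= d ->
  (forall q, uniq (flat q) -> (size q <= k)%N ->
     n%:R ^+ size q * overlap_norm w (pair_sign q) <= d) ->
  forall t q, uniq (flat q ++ t) -> (size q + size t <= k)%N ->
  n%:R ^+ (size q + size t) * overlap_norm w (mixed_sign q t)
    <= (1 + k%:R ^+ 2) ^+ (size q + 2 * size t) * d.
Proof.
move=> kn d0 hd; set K : R := 1 + k%:R ^+ 2.
have K1 : 1 <= K by rewrite lerDl exprn_ge0.
have K0 : 0 <= K by apply: le_trans K1.
elim=> [|x t IH] q uZ qt.
  rewrite !addn0 in qt *; rewrite cats0 in uZ.
  rewrite overlap_norm_mixed_sign0.
  by apply: le_trans (hd q uZ qt) _; rewrite ler_peMl // exprn_ege1.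
rewrite /= in qt.
have qt' : (size q + size t < k)%N by lia.
have := overlap_norm_recurrence w uZ qt' kn.
set D := n%:R - _ - _; set S := overlap_norm _ _ => h.
have Dn : D = (n - (size q).*2 - size t)%:R by rewrite !natrB //; lia.
have D0 : 0 < D by rewrite Dn ltr0n; lia.
(* Since |q| + |t| < k, D >= n - 2k + 2, and n = 2k + (n - 2k) <= k (n - 2k + 2). *)
have DkN : n%:R <= k%:R * D.
  rewrite Dn -natrM ler_nat.
  have : (n - 2 * k + 2 <= n - (size q).*2 - size t)%N by lia.
  move=> h1; apply: (@leq_trans (k * (n - 2 * k + 2))); last by rewrite leq_mul2l h1 orbT.
  rewrite -{1}(subnKC kn) mulnDr addnC mulnC leq_add // leq_pmull //; lia.
have n0 : 0 <= n%:R :> R by [].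
have Z0 : forall m, 0 <= n%:R ^+ m :> R by move=> m; rewrite exprn_ge0.
(* Common bound for the two kinds of terms; [B1] and [B2] add up to D (1 + k^2) A. *)
pose A := K ^+ (size q + 2 * size t).+1 * d.
have A0 : 0 <= A by rewrite mulr_ge0 // exprn_ge0.
have B1 : n%:R ^+ (size q + size t).+1 *
   \sum_(y | y \notin flat q ++ x :: t) overlap_norm w (mixed_sign ((x, y) :: q) t) <= D * A.
  rewrite mulr_sumr; apply: (@le_trans _ _ (\sum_(y | y \notin flat q ++ x :: t) A)).
    apply: ler_sum => y yZ.
    apply: (IH ((x, y) :: q)) => //.
    have pe : perm_eq (flat ((x, y) :: q) ++ t) (y :: flat q ++ x :: t).
      by apply/seq.permP => a; rewrite flat_cons /= !count_cat /=; clear; lia.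
    by rewrite (perm_uniq pe) cons_uniq yZ.
  rewrite sumr_const -[X in X <= _]mulr_natl ler_wpM2r //.
  rewrite Dn ler_nat.
  rewrite (_ : #|_| = #|[pred y | y \notin flat q ++ x :: t]|); last exact: eq_card.
  by rewrite card_notin // size_cat size_flat /=; clear; lia.
have B2 : n%:R ^+ (size q + size t).+1 *
   ((k%:R - (size q)%:R - (size t)%:R) * overlap_norm w (mixed_sign q t)) <= D * (k%:R ^+ 2 * A).
  pose c : R := k%:R - (size q)%:R - (size t)%:R.
  have c0 : 0 <= c.
    by rewrite /c -addrA -opprD -natrD subr_ge0 ler_nat ltnW.
  rewrite -/c.
  have hA : n%:R ^+ (size q + size t) * overlap_norm w (mixed_sign q t) <= A.
    apply: le_trans (IH q _ (ltnW qt')) _.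
      by move: uZ; rewrite !cat_uniq /= negb_or => /and3P[-> /andP[_ ->] /andP[_ ->]].
    by rewrite ler_wpM2r // ler_weXn2l.
  have e1 : n%:R * c <= D * k%:R ^+ 2 :> R.
    apply: (@le_trans _ _ (k%:R * D * k%:R)); last by rewrite expr2; lra.
    by apply: ler_pM => //; rewrite /c -addrA gerDl -opprD -natrD oppr_le0.
  have -> : n%:R ^+ (size q + size t).+1 * (c * overlap_norm w (mixed_sign q t))
     = (n%:R * c) * (n%:R ^+ (size q + size t) * overlap_norm w (mixed_sign q t)).
    by rewrite exprSr; ring.
  rewrite [X in _ <= X]mulrA; apply: ler_pM => //; first exact: mulr_ge0.
  by rewrite mulr_ge0 // overlap_norm_ge0.
rewrite addnS -(ler_pM2l D0) mulrCA.
apply: le_trans (ler_wpM2l (Z0 _) h) _; rewrite mulrDr.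
apply: le_trans (lerD B1 B2) _.
have -> : (size q + 2 * size (x :: t) = (size q + 2 * size t).+2)%N by rewrite /=; clear; lia.
by rewrite [K ^+ _]exprS -mulrA -/A /K; lra.
Qed.

(** On k-sets the function is the indicator of the set of [t], so the overlaps are the values of [w]
    at the images of that set. Their absolute sum is the same for every k-set; adding over all
    k-sets and exchanging the sums makes each permutation contribute [hnorm1 k w]. *)
Lemma overlap_norm_mixed_sign_nil w t : uniq t -> size t = k ->
  'C(n, k)%:R * overlap_norm w (mixed_sign [::] t) = (n`!)%:R * hnorm1 k w.
Proof.
move=> ut tk.
have kernE s e : uniq s -> size s = k -> #|e| = k ->
    mixed_sign [::] s e = (e == [set x in s])%:R.
  move=> us sk ek; rewrite /mixed_sign /pair_sign big_nil mul1r.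
  have [es | ne] := eqVneq e [set x in s].
    by rewrite big_seq big1 // => x xs; rewrite es inE xs.
  have /subsetPn [x] : ~~ ([set x in s] \subset e).
    apply: contra ne => se; rewrite eq_sym eqEcard se /= ek -sk.
    by rewrite cardsE (card_uniqP us).
  by rewrite inE => xs /negbTE xe; rewrite (big_rem x) //= xe mul0r.
have ovlE s f : uniq s -> size s = k ->
    overlap w (mixed_sign [::] s) f = w (f @: [set x in s]).
  move=> us sk; rewrite /overlap (bigD1 [set x in s]) /=; last first.
    by rewrite cardsE (card_uniqP us) sk.
  rewrite kernE ?eqxx ?mul1r ?cardsE ?(card_uniqP us) // big1 ?addr0 //.
  by move=> e /andP[/eqP ek /negbTE ne]; rewrite kernE // ne mul0r.
have sumE (e : {set 'I_n}) : #|e| == k ->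
    overlap_norm w (mixed_sign [::] t) = \sum_(f : {perm 'I_n}) `|w (f @: e)|.
  move=> /eqP ek; have sk : size (enum e) = k by rewrite -cardE.
  rewrite (@overlap_norm_mixed_sign_uniq _ [::] t (enum e)) ?enum_uniq ?sk ?tk //.
  by apply: eq_bigr => f _; rewrite ovlE ?enum_uniq // set_enum.
have <- : #|[set e : {set 'I_n} | #|e| == k]| = 'C(n, k).
  by rewrite card_draws card_ord.
rewrite mulr_natl -sumr_const.
rewrite (eq_bigr (fun e : {set 'I_n} => \sum_(f : {perm 'I_n}) `|w (f @: e)|)); last first.
  by move=> e; rewrite inE => /sumE.
rewrite exchange_big /= (eq_bigr (fun=> hnorm1 k w)); last first.
  move=> f _; rewrite -[RHS](reindex_ksets k f).
  by apply: eq_bigl => e; rewrite inE.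
by rewrite sumr_const -[LHS]mulr_natl card_Sn.
Qed.

(** If every level fell below d = X / (2K), the previous bound for k single vertices would give n^k
    S <= K d = X / 2, where S is their overlap norm. But X = C(n,k) S <= n^k S. *)
Lemma exists_level w (r : seq ('I_n * 'I_n)) : (2 * k <= n)%N ->
  uniq (flat r) -> size r = k -> wsum k w [set: 'I_n] = 0 -> (0 < k)%N ->
  exists j : 'I_k, (n`!)%:R * hnorm1 k w <=
    2 * (1 + k%:R ^+ 2) ^+ (2 * k) * (n%:R ^+ j.+1 * overlap_norm w (pair_sign (take j.+1 r))).
Proof.
move=> kn ur rk w0 k0.
have [//|nex] := pselect (exists j : 'I_k, (n`!)%:R * hnorm1 k w <=
    2 * (1 + k%:R ^+ 2) ^+ (2 * k) * (n%:R ^+ j.+1 * overlap_norm w (pair_sign (take j.+1 r)))).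
exfalso; set K : R := (1 + k%:R ^+ 2) ^+ (2 * k) in nex.
have K0 : 0 < K by rewrite exprn_gt0 // ltr_pwDl // exprn_ge0.
pose X := (n`!)%:R * hnorm1 k w.
have X0 : 0 <= X by rewrite mulr_ge0 // sumr_ge0.
pose d := X / (2 * K).
have d0 : 0 <= d by rewrite divr_ge0 // mulr_ge0 // ltW.
have small j : (j < k)%N -> n%:R ^+ j.+1 * overlap_norm w (pair_sign (take j.+1 r)) < d.
  move=> jk; rewrite ltNge; apply/negP => h; apply: nex; exists (Ordinal jk).
  by move: h; rewrite /d ler_pdivrMr ?mulr_gt0 //= mulrC.
(* The failed levels give strict inequalities with nonnegative left sides, so d > 0; this makes X /
   2 < X. *)
have X1 : 0 < X.
  have : 0 < d.
    by apply: le_lt_trans (small 0%N k0); rewrite mulr_ge0 ?overlap_norm_ge0 // exprn_ge0.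
  by rewrite /d pmulr_lgt0 // invr_gt0 mulr_gt0.
have uf i : uniq (flat (take i r)).
  by move: ur; rewrite -{1}(cat_take_drop i r) flat_cat cat_uniq => /and3P[].
have hyp q : uniq (flat q) -> (size q <= k)%N ->
     n%:R ^+ size q * overlap_norm w (pair_sign q) <= d.
  (* Level zero: [pair_sign [::]] is 1, so every overlap equals w([n]) = 0. *)
  case: (posnP (size q)) => [/size0nil -> _ _|q0 uq qk].
    rewrite mul1r /overlap_norm big1 // => f _; rewrite (_ : overlap _ _ _ = 0) ?normr0 //.
    rewrite -[RHS]w0 /wsum /overlap -[LHS](reindex_ksets k f^-1%g).
    apply: eq_big => e; first by rewrite subsetT.
    by rewrite /pair_sign big_nil mul1r -imset_permM mulVg imset_perm1.
  apply: ltW; have -> : overlap_norm w (pair_sign q) = overlap_norm w (pair_sign (take (size q) r)).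
    by rewrite -!overlap_norm_mixed_sign0;
      apply: overlap_norm_mixed_sign_uniq; rewrite ?cats0 // size_takel // rk.
  by have := @small (size q).-1; rewrite prednK //; apply.
have [t ut tk] : exists2 t : seq 'I_n, uniq t & size t = k.
  exists (take k (flat r)); first exact: take_uniq.
  by rewrite size_takel // size_flat rk -addnn leq_addr.
have := overlap_norm_mixed_sign_le kn d0 hyp (t := t) (q := [::]) ut.
rewrite /= add0n tk leqnn => /(_ isT); rewrite -/K /d.
rewrite [X in _ <= X](_ : _ = X / 2); last by field; rewrite gt_eqF.
apply/negP; rewrite -ltNge; apply: (@lt_le_trans _ _ X); first by lra.
rewrite /X -(overlap_norm_mixed_sign_nil w ut tk) ler_wpM2r ?overlap_norm_ge0 //.
rewrite -natrX ler_nat.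
by rewrite bin_le_expn.
Qed.

End Pairing.

(** * Averaging over sign-preserving permutations *)

Section Terminal.
Variables (R : realType) (n k : nat).
Implicit Types (w u : {set 'I_n} -> R) (e : {set 'I_n}).
Implicit Types (q r : seq ('I_n * 'I_n)).
Local Notation pair_sign := (@pair_sign R n).

Definition flip (p : 'I_n * 'I_n) e : {set 'I_n} := tperm p.1 p.2 @: e.

Lemma mem_flip p e x : (x \in flip p e) = (tperm p.1 p.2 x \in e).
Proof. by rewrite mem_imset_perm tpermV. Qed.

Lemma flipK p : involutive (flip p).
Proof. by move=> e; apply/setP => x; rewrite !mem_flip tpermK. Qed.

Lemma perm_pair_sign q r e : perm_eq q r -> pair_sign q e = pair_sign r e.
Proof. exact: perm_big. Qed.

Lemma pair_sign_cons p q e :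
  pair_sign (p :: q) e = ((p.1 \in e)%:R - (p.2 \in e)%:R) * pair_sign q e.
Proof. by rewrite /pair_sign big_cons. Qed.

Lemma pair_sign_fix (f : {perm 'I_n}) q e :
  {in flat q, forall x, f x = x} -> pair_sign q (f @: e) = pair_sign q e.
Proof.
move=> fx; apply: eq_big_seq => p /mem_flat /andP[p1 p2].
have fV x : x \in flat q -> (f^-1)%g x = x by move=> /fx {1}<-; rewrite permK.
by rewrite !mem_imset_perm !fV.
Qed.

Lemma tperm_notin (s : seq 'I_n) a b : a \notin s -> b \notin s ->
  {in s, forall x, tperm a b x = x}.
Proof.
by move=> ha hb x xs; rewrite tpermD //; apply/eqP => h; move: xs;
  rewrite -h ?(negbTE ha) ?(negbTE hb).
Qed.

Lemma pair_sign_flip p q e : p \in q -> uniq (flat q) ->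
  pair_sign q (flip p e) = - pair_sign q e.
Proof.
move=> pq uq; have pe := perm_to_rem pq.
move: uq; rewrite (perm_uniq (perm_flat pe)) flat_cons /= inE negb_or.
move=> /and3P[/andP[p12 p1] p2 _]; rewrite !(perm_pair_sign _ pe) !pair_sign_cons.
rewrite pair_sign_fix ?mem_flip ?tpermL ?tpermR; last exact: tperm_notin.
by rewrite -mulNr opprB.
Qed.

Lemma pair_sign_sqr q e : pair_sign q e != 0 -> pair_sign q e * pair_sign q e = 1.
Proof.
elim: q => [|p q IH]; first by rewrite /pair_sign big_nil mulr1.
rewrite pair_sign_cons mulf_eq0 negb_or => /andP[hp /IH hq].
rewrite mulrACA hq; move: hp.
by case: (p.1 \in e); case: (p.2 \in e); rewrite ?subrr ?eqxx // => _ /=; ring.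
Qed.

Lemma pair_sign_le1 q e : `|pair_sign q e| <= 1.
Proof.
have [->|/pair_sign_sqr h] := eqVneq (pair_sign q e) 0; first by rewrite normr0.
by rewrite -(@ler_pXn2r _ 2) ?nnegrE // -normrX expr2 h normr1 expr1n.
Qed.

Lemma pair_sign_xor q p e : pair_sign q e != 0 -> p \in q -> (p.2 \in e) = ~~ (p.1 \in e).
Proof.
move=> nz pq; move: nz; rewrite (perm_pair_sign _ (perm_to_rem pq)) pair_sign_cons.
rewrite mulf_eq0 negb_or => /andP[].
by case: (p.1 \in e); case: (p.2 \in e); rewrite ?subrr ?eqxx.
Qed.

(** If [e] and [g] agree on every pair, any a in e \ g and b in g \ e lie outside the pairs and
    their transposition fixes the sign. Otherwise swap a pair on which they differ, which negates
    the sign. *)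
Lemma exchange_step q e (g : {set 'I_n}) : uniq (flat q) -> #|e| = #|g| ->
  pair_sign q e != 0 -> pair_sign q g != 0 -> e != g ->
  exists a b (d : R), [/\ a \in e :\: g, b \in g :\: e, d * d = 1 &
    forall h : {set 'I_n}, pair_sign q (tperm a b @: h) = d * pair_sign q h].
Proof.
move=> uq eg se unit_sign ne.
have [|] := boolP (all (fun p => (p.1 \in e) == (p.1 \in g)) q).
  move/allP => same.
  have agree x : x \in flat q -> (x \in e) = (x \in g).
    move=> /flatP [p pq] /orP[] /eqP ->; first exact/eqP/same.
    by rewrite (pair_sign_xor se pq) (pair_sign_xor unit_sign pq) (eqP (same p pq)).
  have [a ae] : exists a, a \in e :\: g.
    apply/set0Pn; rewrite setD_eq0; apply: contra ne => sub.
    by rewrite eqEcard sub eg leqnn.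
  have [b be] : exists b, b \in g :\: e.
    apply/set0Pn; rewrite setD_eq0; apply: contra ne => sub.
    by rewrite eq_sym eqEcard sub eg leqnn.
  exists a, b, 1; split=> //; first by rewrite mulr1.
  move=> h; rewrite mul1r pair_sign_fix //; apply: tperm_notin.
    by apply/negP => /agree; move: ae; rewrite inE => /andP[/negbTE -> ->].
  by apply/negP => /agree; move: be; rewrite inE => /andP[/negbTE -> ->].
move=> /allPn [p pq npq].
have fl (h : {set _}) : pair_sign q (tperm p.1 p.2 @: h) = -1 * pair_sign q h.
  by rewrite mulN1r; apply: pair_sign_flip.
have m1 : -1 * -1 = 1 :> R by rewrite mulrNN mulr1.
have [p1 | p1] := boolP (p.1 \in e).
  have p1g : p.1 \notin g by move: npq; rewrite p1; case: (p.1 \in g).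
  exists p.1, p.2, (-1); split=> //; rewrite inE ?p1 ?p1g //.
  by rewrite (pair_sign_xor se pq) (pair_sign_xor unit_sign pq) p1 p1g.
have p1g : p.1 \in g by move: npq; rewrite (negbTE p1); case: (p.1 \in g).
exists p.2, p.1, (-1); split=> //; rewrite ?inE ?p1 ?p1g //.
  by rewrite (pair_sign_xor se pq) (pair_sign_xor unit_sign pq) p1 p1g.
by move=> h; rewrite tpermC.
Qed.

(** Each exchange step moves [e] to a set with smaller e \ g and keeps the sign nonzero; induct on
    |e \ g|. *)
Lemma semi_invariant_const q (phi : {set 'I_n} -> R) : uniq (flat q) ->
  (forall a b (d : R), d * d = 1 ->
     (forall h : {set 'I_n}, pair_sign q (tperm a b @: h) = d * pair_sign q h) ->
     forall e, phi (tperm a b @: e) = phi e) ->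
  forall e (g : {set 'I_n}), #|e| = #|g| ->
    pair_sign q e != 0 -> pair_sign q g != 0 -> phi e = phi g.
Proof.
move=> uq inv e g; move: {2}#|e :\: g| (leqnn #|e :\: g|) => m.
elim: m e => [|m IH] e hm eg se unit_sign.
  suff -> : e = g by [].
  by apply/eqP; rewrite eqEcard eg leqnn andbT -setD_eq0 -cards_eq0 -leqn0.
have [-> //|ne] := eqVneq e g.
have [a [b [d [ae be dd hd]]]] := exchange_step uq eg se unit_sign ne.
rewrite -(inv _ _ _ dd hd); apply: IH => //; last 2 first.
- by rewrite card_imset_perm.
- rewrite hd mulf_neq0 //; apply/eqP => d0; move/esym/eqP: dd.
  by rewrite d0 mul0r oner_eq0.
rewrite -ltnS; apply: leq_trans hm; apply: proper_card; apply/properP; split.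
  apply/subsetP => x; rewrite !inE mem_imset_perm tpermV.
  case: tpermP => [->|->|//]; move: ae be; rewrite !inE.
    by move=> _ /andP[/negbTE ->]; rewrite andbF.
  by move=> _ /andP[_ ->].
exists a => //; rewrite !inE mem_imset_perm tpermV tpermL.
by move: be; rewrite inE => /andP[/negbTE ->]; rewrite andbF.
Qed.

(** The sum counts the k-sets with one vertex in each pair. Such a set is determined by its trace on
    the 2|q| paired vertices and its k - |q| remaining vertices. *)
Lemma card_transversal q : uniq (flat q) -> (size q <= k)%N ->
  \sum_(e : {set 'I_n} | #|e| == k) pair_sign q e * pair_sign q e
    <= (4 ^ size q * n ^ (k - size q))%:R.
Proof.
move=> uq qk; set V := [set x in flat q].
pose T := [set e : {set 'I_n} | (#|e| == k) && (pair_sign q e != 0)].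
apply: (@le_trans _ _ #|T|%:R).
  rewrite -sum1_card natr_sum [X in _ <= X](eq_bigl (fun e => (#|e| == k) && (pair_sign q e != 0))).
    rewrite big_mkcondr; apply: ler_sum => e _.
    by case: eqVneq => [->|/pair_sign_sqr ->]; rewrite ?mul0r.
  by move=> e; rewrite inE.
rewrite ler_nat.
pose h e := (e :&: V, e :\: V).
have hinj : injective h.
  by move=> e g [h1 h2]; rewrite -(setID e V) h1 h2 setID.
rewrite -(card_imset _ hinj).
apply: (@leq_trans #|setX (powerset V) [set e : {set 'I_n} | #|e| == k - size q]|%N).
  apply/subset_leq_card/subsetP => x /imsetP [e]; rewrite inE => /andP[/eqP ek se] ->.
  rewrite !inE /= subsetIr /=; rewrite cardsD ek; apply/eqP; congr (_ - _)%N.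
  have [|<- _] := @mixed_sign_neq0 R n q [::] e; first by rewrite /mixed_sign big_nil mulr1.
  rewrite -size_filter -(card_uniqP (filter_uniq _ uq)).
  by apply: eq_card => y; rewrite !inE mem_filter.
rewrite cardsX card_powerset card_draws card_ord cardsE (card_uniqP uq) size_flat.
by rewrite -mul2n expnM leq_mul ?bin_le_expn.
Qed.

Lemma pair_sign_eq0P q e : pair_sign q e = 0 ->
  exists2 p, p \in q & flip p e = e.
Proof.
move=> /eqP; rewrite /pair_sign prodf_seq_eq0 => /hasP [p pq /= h]; exists p => //.
have {}h : (p.1 \in e) = (p.2 \in e).
  by move: h; case: (p.1 \in e); case: (p.2 \in e); rewrite ?subr0 ?sub0r ?oppr_eq0 ?oner_eq0.
by apply/setP => x; rewrite mem_flip; case: tpermP => [->|->|].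
Qed.

(* Averaging u over the permutations that preserve pair_sign q up to sign, with that
   sign, turns u into a multiple of pair_sign q on k-sets. *)
Lemma overlap_norm_ge_dotp w u q : uniq (flat q) -> (size q <= k)%N ->
  `|dotp k u (pair_sign q)| * overlap_norm k w (pair_sign q)
    <= (4 ^ size q * n ^ (k - size q))%:R * overlap_norm k w u.
Proof.
move=> uq qk; have := card_transversal uq qk.
set N := \sum_(e | _) _; set B := _%:R => NB.
have L0 := overlap_norm_ge0 k w u.
have B0 : 0 <= B by [].
have [e0 /= /andP[e0k s0]|none] :=
    pickP [pred e : {set 'I_n} | (#|e| == k) && (pair_sign q e != 0)]; last first.
  rewrite (_ : dotp k u _ = 0) ?normr0 ?mul0r ?mulr_ge0 //.
  by apply: big1 => e ek; have /= := none e; rewrite ek => /eqP ->; rewrite mulr0.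
(* If [g] preserves [pair_sign q] up to a sign, that sign can be read off at [e0]; [P] singles out
   these [g], and [c] is zero on all others. *)
pose c0 (g : {perm 'I_n}) : R := pair_sign q (g @: e0) * pair_sign q e0.
pose P (g : {perm 'I_n}) := [forall e : {set 'I_n}, pair_sign q (g @: e) == c0 g * pair_sign q e].
pose c g : R := if P g then c0 g else 0.
have cP g : P g -> forall e : {set 'I_n}, pair_sign q (g @: e) = c g * pair_sign q e.
  by move=> Pg e; rewrite /c Pg; move/forallP: Pg => /(_ e)/eqP.
have half (g0 : {perm _}) (d : R) :
    (forall h : {set 'I_n}, pair_sign q (g0 @: h) = d * pair_sign q h) ->
    forall g, P g -> P (g0 * g)%g /\ c (g0 * g)%g = d * c g.
  move=> hd g Pg.
  have e1 (e : {set 'I_n}) : pair_sign q ((g0 * g)%g @: e) = d * c g * pair_sign q e.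
    by rewrite imset_permM cP // hd; ring.
  have e2 : c0 (g0 * g)%g = d * c g by rewrite /c0 e1 -mulrA pair_sign_sqr ?mulr1.
  have PP : P (g0 * g)%g by apply/forallP => e; rewrite e1 e2.
  by rewrite {1}/c PP.
(* Multiplying by [g0] or by its inverse preserves [P], so outside [P] both sides vanish. *)
have cM (g0 : {perm _}) (d : R) : d * d = 1 ->
    (forall h : {set 'I_n}, pair_sign q (g0 @: h) = d * pair_sign q h) ->
    forall g, c (g0 * g)%g = d * c g.
  move=> dd hd g; have [Pg | nPg] := boolP (P g); first by case: (half _ _ hd g Pg).
  rewrite [c g]/c (negbTE nPg) mulr0 /c; case: ifP => // Pgg.
  case/negP: nPg; have hdV (h : {set 'I_n}) : pair_sign q (g0^-1%g @: h) = d * pair_sign q h.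
    have -> : pair_sign q h = d * pair_sign q (g0^-1%g @: h).
      by rewrite -hd -imset_permM mulVg imset_perm1.
    by rewrite mulrA dd mul1r.
  by have [] := half _ _ hdV _ Pgg; rewrite mulgA mulVg mul1g.
pose ub e : R := \sum_g c g * translate u g e.
have ubM (g0 : {perm _}) (d : R) : d * d = 1 ->
    (forall h : {set 'I_n}, pair_sign q (g0 @: h) = d * pair_sign q h) ->
    forall e : {set 'I_n}, ub (g0 @: e) = d * ub e.
  move=> dd hd e; rewrite /ub -(sum_perm_mulgl g0 (fun g => c g * translate u g e)) mulr_sumr.
  apply: eq_bigr => g _; rewrite (cM _ _ dd hd) !mulrA dd mul1r.
  by rewrite /translate imset_permM.
have ub0 e : pair_sign q e = 0 -> ub e = 0.
  move=> /pair_sign_eq0P [p pq fe].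
  have h1 (h : {set 'I_n}) : pair_sign q (tperm p.1 p.2 @: h) = -1 * pair_sign q h.
    by rewrite mulN1r; apply: pair_sign_flip.
  have dd : -1 * -1 = 1 :> R by rewrite mulrNN mulr1.
  by have := ubM _ _ dd h1 e; rewrite -/(flip p e) fe mulN1r => ?; lra.
(* [ub] times [pair_sign q] is invariant under every sign-preserving transposition, hence constant
   on the k-sets of nonzero sign; [kap] is that constant. *)
pose kap := ub e0 * pair_sign q e0.
have ubE (e : {set 'I_n}) : #|e| = k -> ub e = kap * pair_sign q e.
  move=> ek; have [s|s] := eqVneq (pair_sign q e) 0; first by rewrite s mulr0 ub0.
  rewrite /kap (@semi_invariant_const q (fun e => ub e * pair_sign q e) uq _ e0 e) //.
  - by rewrite -mulrA pair_sign_sqr ?mulr1.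
  - by move=> a b d dd hd h; rewrite (ubM _ _ dd hd) hd mulrACA dd mul1r.
  - by rewrite (eqP e0k) ek.
pose G : R := #|[pred g | P g]|%:R.
have G0 : 0 < G.
  rewrite ltr0n; apply/card_gt0P; exists 1%g; rewrite inE; apply/forallP => e.
  by rewrite /c0 !imset_perm1 pair_sign_sqr ?mul1r.
have GE : G = \sum_g (P g)%:R.
  by rewrite /G -sum1_card natr_sum big_mkcond; apply: eq_bigr => g _; rewrite inE; case: (P g).
have hub : overlap_norm k w ub <= G * overlap_norm k w u.
  rewrite GE mulr_suml.
  apply: (@le_trans _ _ (\sum_g `|c g| * overlap_norm k w (translate u g))).
    rewrite /overlap_norm (eq_bigr _ (fun g _ => mulr_sumr _ _ _ _)) exchange_big.
    apply: ler_sum => f _ /=; rewrite overlap_sum; apply: le_trans (ler_norm_sum _ _ _) _.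
    by apply: ler_sum => g _; rewrite overlapZ normrM.
  apply: ler_sum => g _; rewrite overlap_norm_translate ler_wpM2r // /c /c0.
  case: (P g); rewrite ?normr0 // normrM -[X in _ <= X]mulr1.
  by apply: ler_pM => //; apply: pair_sign_le1.
have hS : overlap_norm k w ub = `|kap| * overlap_norm k w (pair_sign q).
  rewrite /overlap_norm mulr_sumr; apply: eq_bigr => f _.
  by rewrite (eq_overlap w f (fun e ek => ubE e ek)) overlapZ normrM.
(* The inner product of [ub] with [pair_sign q] is evaluated twice, which expresses [kap] through
   that of [u]. *)
have hD1 : dotp k ub (pair_sign q) = kap * N.
  rewrite /dotp /N mulr_sumr; apply: eq_bigr => e /eqP ek.
  by rewrite ubE // mulrA.
have hD2 : dotp k ub (pair_sign q) = G * dotp k u (pair_sign q).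
  rewrite /dotp GE mulr_suml (eq_bigr _ (fun e _ => mulr_suml _ _ _ _)).
  rewrite exchange_big; apply: eq_bigr => g _ /=.
  rewrite mulr_sumr -[RHS](reindex_ksets k g); apply: eq_bigr => e _.
  have [Pg|nPg] := boolP (P g); last by rewrite /c (negbTE nPg) !mul0r.
  by rewrite mul1r (cP g Pg) /translate mulrA [u _ * _]mulrC.
have N0 : 0 <= N by apply: sumr_ge0 => e _; rewrite -expr2 sqr_ge0.
have e1 : G * `|dotp k u (pair_sign q)| = `|kap| * N.
  by rewrite -(ger0_norm (ltW G0)) -normrM -hD2 hD1 normrM (ger0_norm N0).
rewrite -(ler_pM2l G0) mulrA e1 mulrAC -hS mulrC.
apply: (@le_trans _ _ (N * (G * overlap_norm k w u))); first exact: ler_wpM2l.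
by rewrite mulrCA ler_wpM2l ?(ltW G0) // ler_wpM2r.
Qed.

End Terminal.

(** * Flipping a block of disjoint pairs *)

(** The factor 4 is the cost of reading the slope of an affine polynomial from two values; each
    factor [1 + 2 ^ i.+2] is the cost of removing the coefficient of degree i + 2. *)
Definition extract_const (m : nat) : nat := 4 * \prod_(i < m) (1 + 2 ^ i.+2).

(* Passing from p(x) to p(x) - 2^d p(x/2) kills the degree d coefficient and
   changes the linear one by the factor 1 - 2^(d-1). *)
Lemma coef1_le (K : numFieldType) (m : nat) (p : {poly K}) (b M : K) :
  (size p <= m.+2)%N -> (forall l, `|p.[b / 2 ^+ l]| <= M) ->
  `|p`_1 * b| <= (extract_const m)%:R * M.
Proof.
elim: m p M => [|m IH] p M sp hM.
  have hp x : p.[x] = p`_0 + p`_1 * x.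
    rewrite (horner_coef_wide _ sp) big_ord_recl big_ord1 /=.
    by rewrite expr0 mulr1 expr1.
  have -> : p`_1 * b = 2 * (p.[b / 2 ^+ 0] - p.[b / 2 ^+ 1]).
    by rewrite !hp expr0 expr1; field.
  rewrite /extract_const big_ord0 muln1 normrM ger0_norm //.
  apply: (@le_trans _ _ (2 * (M + M))); last by rewrite (_ : 2 * (M + M) = 4%:R * M) //; ring.
  by rewrite ler_wpM2l //; apply: le_trans (ler_normB _ _) (lerD (hM _) (hM _)).
pose q := \poly_(i < m.+2) (p`_i * (1 - 2 ^+ m.+2 / 2 ^+ i)).
have hq x : q.[x] = p.[x] - 2 ^+ m.+2 * p.[x / 2].
  rewrite horner_poly !(horner_coef_wide _ sp) [in RHS]big_ord_recr /=.
  rewrite [X in _ - _ * X]big_ord_recr /= mulrDr mulr_sumr opprD addrACA -sumrB.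
  rewrite (_ : _ - _ * _ = 0) ?addr0.
    by apply: eq_bigr => i _; rewrite exprMn exprVn; ring.
  by rewrite exprMn exprVn; field; rewrite expf_neq0 // pnatr_eq0.
have hqM l : `|q.[b / 2 ^+ l]| <= (1 + 2 ^ m.+2)%:R * M.
  rewrite hq natrD mulrDl mul1r; apply: le_trans (ler_normB _ _) _.
  apply: lerD => //; rewrite normrM natrX ger0_norm ?exprn_ge0 // ler_wpM2l ?exprn_ge0 //.
  by rewrite -mulrA -invfM -exprSr.
have := IH q _ (size_poly _ _) hqM.
rewrite coef_poly /= expr1 mulrA -natrM.
have -> : (extract_const m * (1 + 2 ^ m.+2) = extract_const m.+1)%N.
  by rewrite /extract_const big_ord_recr /= mulnA.
(* The linear coefficient of [q] is that of [p] times 1 - 2^(m+1), whose absolute value is at least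
   1. *)
move=> h; apply: le_trans h; rewrite mulrAC [X in _ <= X]normrM ler_peMr //.
rewrite exprSr mulfK ?pnatr_eq0 // -natrX distrC ger0_norm.
  by rewrite lerBrDr -(natrD _ 1 1) ler_nat (leq_pexp2l _ (ltn0Sn m)).
by rewrite subr_ge0 ler1n expn_gt0.
Qed.

Section Twist.
Variables (R : realType) (A : eqType) (X : Type) (fl : A -> X -> X).
Implicit Types (B : seq A) (F : X -> R) (s : A -> R).

(* With fl p commuting involutions, twist is the product over B of
   (average over fl p) + s_p 'X (half-difference under fl p). *)
Fixpoint twist s B F x : {poly R} :=
  if B is p :: B' then
    2^-1 *: ((1 + s p *: 'X) * twist s B' F x
             + (1 - s p *: 'X) * twist s B' F (fl p x))
  else (F x)%:P.

Fixpoint flip_avg B F x : R :=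
  if B is p :: B' then 2^-1 * (flip_avg B' F x + flip_avg B' F (fl p x)) else F x.

(* linear_part B r is the coefficient of s_r 'X in the product defining twist. *)
Fixpoint linear_part B (r : A) F x : R :=
  if B is p :: B' then
    if r == p then 2^-1 * (flip_avg B' F x - flip_avg B' F (fl p x))
    else 2^-1 * (linear_part B' r F x + linear_part B' r F (fl p x))
  else 0.

Lemma coef_twist s p B F x i : (twist s (p :: B) F x)`_i =
  2^-1 * ((twist s B F x)`_i + (twist s B F (fl p x))`_i
    + (if i is j.+1 then
         s p * ((twist s B F x)`_j - (twist s B F (fl p x))`_j) else 0)).
Proof.
rewrite /= coefZ !mulrDl mulNr !mul1r -!scalerAl !coefD coefN !coefZ !coefXM.
by case: i => [|i] /=; ring.
Qed.

Lemma twist_coef0 s B F x : (twist s B F x)`_0 = flip_avg B F x.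
Proof.
elim: B x => [|p B IH] x; first by rewrite coefC.
by rewrite coef_twist !IH addr0.
Qed.

Lemma twist_coef1 s B F x : uniq B ->
  (twist s B F x)`_1 = \sum_(r <- B) s r * linear_part B r F x.
Proof.
elim: B x => [|p B IH] x; first by rewrite big_nil coefC.
move=> /andP[pB uB]; rewrite coef_twist !twist_coef0 !IH // big_cons /= eqxx.
rewrite mulrDr addrC mulrCA; congr (_ + _).
rewrite -big_split mulr_sumr; apply: eq_big_seq => r rB /=.
have -> : (r == p) = false by apply: contraNF pB => /eqP <-.
by ring.
Qed.

(** With c = s_p t in [-1, 1], the weights (1 + c)/2 and (1 - c)/2 are nonnegative with sum 1, so
    the value is a convex combination of values of [F]. *)
Lemma twist_le s B F (M t : R) x : (forall y, `|F y| <= M) ->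
  (forall p, `|s p| <= 1) -> `|t| <= 1 -> `|(twist s B F x).[t]| <= M.
Proof.
move=> hM hs ht; elim: B x => [|p B IH] x; first by rewrite /= hornerC.
rewrite /= !hornerE.
have : `|s p * t| <= 1 by rewrite normrM -[1]mulr1 ler_pM.
set c := s p * t; rewrite ler_norml => /andP[c1 c2].
rewrite normrM ger0_norm ?invr_ge0 // -ler_pdivlMl ?invr_gt0 // invrK.
apply: le_trans (ler_normD _ _) _; rewrite !normrM.
rewrite (@ger0_norm _ (1 + c)) ?(@ger0_norm _ (1 - c)); [|lra|lra].
have := ler_wpM2l (_ : 0 <= 1 + c) (IH x); have := ler_wpM2l (_ : 0 <= 1 - c) (IH (fl p x)).
move=> /(_ ltac:(lra)) h1 /(_ ltac:(lra)) h2; lra.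
Qed.

(* Since |1 + it|/2 + |1 - it|/2 = sqrt (1 + t^2), evaluating at it with t of order
   1 / sqrt (size B) costs only a bounded factor in L^1; this is what yields the
   sqrt (size B) of [linear_part_le_avg]. *)
Lemma twist_le_complex s B F (t : R) x : (forall p, s p * s p = 1) ->
  `|(map_poly (real_complex R) (twist s B F x)).[(0 +i* t)%C]|
    <= (Num.sqrt (1 + t ^+ 2) ^+ size B * flip_avg B (fun y => `|F y|) x)%:C%C.
Proof.
move=> hs; elim: B x => [|p B IH] x /=.
  by rewrite mul1r map_polyC hornerC /= normc_def /= expr0n addr0 sqrtr_sqr.
set N := Num.sqrt _ in IH *; move ME: (N ^+ _ * _) => M.
rewrite map_polyZ rmorphD !rmorphM rmorphB rmorphD rmorph1 /= map_polyZ map_polyX.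
rewrite !hornerE /=.
have hN (c : R) : c * c = 1 -> `|1 + c%:C%C * (0 +i* t)%C| = N%:C%C.
  move=> cc; have -> : 1 + c%:C%C * (0 +i* t)%C = (1 +i* (c * t))%C.
    by apply/eqP; rewrite eq_complex /= !mul0r !mulr0 subr0 !addr0 add0r !eqxx.
  by rewrite normc_def /= /N expr1n exprMn expr2 cc mul1r.
rewrite normrM.
have -> : `|(2^-1)%:C%C| = (2^-1 : R)%:C%C.
  by rewrite normc_def /= expr0n addr0 sqrtr_sqr ger0_norm ?invr_ge0.
have -> : M = 2^-1 * (N * (N ^+ size B * flip_avg B (fun y => `|F y|) x)
                      + N * (N ^+ size B * flip_avg B (fun y => `|F y|) (fl p x))).
  by rewrite -ME exprS; ring.
rewrite rmorphM ler_wpM2l ?ler0c ?invr_ge0 // rmorphD.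
apply: le_trans (ler_normD _ _) _; rewrite !normrM -mulNr -rmorphN.
rewrite !hN ?mulrNN // !(rmorphM _ N).
by apply: lerD; apply: ler_wpM2l => //; rewrite ler0c sqrtr_ge0.
Qed.

End Twist.

(** By induction (1 + x)^b (1 - b x) <= 1, and here 1 - a x >= 3/4. *)
Lemma exp_one_plus_le (R : realFieldType) (a : nat) (x : R) :
  0 <= x -> a%:R * x <= 4^-1 -> (1 + x) ^+ a <= 2.
Proof.
move=> x0 ax.
have h (b : nat) : (1 + x) ^+ b * (1 - b%:R * x) <= 1.
  elim: b => [|b IH]; first by rewrite expr0 mul0r subr0 mulr1.
  apply: le_trans IH; rewrite exprSr -mulrA ler_wpM2l ?exprn_ge0 ?addr_ge0 //.
  have : 0 <= (b.+1)%:R * (x * x) by rewrite mulr_ge0 // mulr_ge0.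
  by rewrite -[b.+1]addn1 natrD; lra.
have := h a; have : 0 <= (1 + x) ^+ a by rewrite exprn_ge0 // addr_ge0.
by nra.
Qed.

Section Block.
Variables (R : realType) (n k : nat).
Implicit Types (w u : {set 'I_n} -> R) (e : {set 'I_n}).
Implicit Types (q r B : seq ('I_n * 'I_n)).

Definition pflip (p : 'I_n * 'I_n) (f : {perm 'I_n}) := (tperm p.1 p.2 * f)%g.

Definition splits e (p : 'I_n * 'I_n) := (p.1 \in e) (+) (p.2 \in e).

Lemma flip_id p e : ~~ splits e p -> flip p e = e.
Proof.
rewrite /splits => h; apply/setP => x; rewrite mem_flip.
case: tpermP => [->|->|//]; move: h;
by case: (p.1 \in e); case: (p.2 \in e).
Qed.

(** A pair not split by [e] has flip p e = e, and its factor collapses to 1; only split pairs raise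
    the degree. As the pairs are disjoint, a k-set splits at most k of them. *)
Lemma size_twist s B u e : uniq (flat B) ->
  (size (twist (@flip n) s B u e) <= (count (splits e) B).+1)%N.
Proof.
elim: B e => [|p B IH] e uB; first exact: size_polyC_leq1.
have uB' : uniq (flat B) by move: uB; rewrite flat_cons /= => /and3P[].
rewrite [twist _ _ _ _ _]/=; apply: leq_trans (size_scale_leq _ _) _.
have sz (c : R) : (size (1 + c *: 'X : {poly R})%R <= 2)%N.
  apply: leq_trans (size_polyD _ _) _; rewrite size_poly1 geq_max /=.
  by apply: leq_trans (size_scale_leq _ _) _; rewrite size_polyX.
have [sp|nsp] := boolP (splits e p); last first.
  rewrite (flip_id nsp) -mulrDl (_ : _ + _ = 2%:P).
    rewrite mul_polyC; apply: leq_trans (size_scale_leq _ _) _.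
    by apply: leq_trans (IH e uB') _; rewrite /= (negbTE nsp).
  by rewrite addrACA subrr addr0 -polyCD.
have cf : count (splits (flip p e)) B = count (splits e) B.
  apply: eq_in_count => r /mem_flat /andP[r1 r2]; rewrite /splits !mem_flip.
  move: uB; rewrite flat_cons /= inE negb_or => /and3P[/andP[_ h1] h2 _].
  by rewrite !(tperm_notin h1 h2).
have aux (a b c : nat) : (a <= 2)%N -> (b <= c.+1)%N -> ((a + b).-1 <= c.+2)%N.
  by clear; lia.
rewrite /= sp add1n.
apply: leq_trans (size_polyD _ _) _; rewrite geq_max; apply/andP; split.
  exact: leq_trans (size_polyMleq _ _) (aux _ _ _ (sz _) (IH _ uB')).
apply: leq_trans (size_polyMleq _ _) _; rewrite -cf -scaleNr.
exact: aux (sz _) (IH _ uB').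
Qed.

Lemma count_splits e B : uniq (flat B) -> (count (splits e) B <= #|e|)%N.
Proof.
move=> uB; apply: (@leq_trans (count (mem e) (flat B))).
  elim: B {uB} => // p B IH; rewrite flat_cons /= addnA; apply: leq_add => //.
  by rewrite /splits; case: (p.1 \in e); case: (p.2 \in e).
rewrite -size_filter -(card_uniqP (filter_uniq _ uB)).
by apply/subset_leq_card/subsetP => x; rewrite mem_filter => /andP[].
Qed.

(** Substituting flip p e for e in the sum moves the flips from the permutation to [u]. The degree
    bound for each single [e] thus passes to the twisted overlap. *)
Lemma twist_overlap s B w u f :
  twist pflip s B (overlap k w u) f =
  \sum_(e : {set 'I_n} | #|e| == k) w (f @: e) *: twist (@flip n) s B u e.
Proof.
elim: B f => [|p B IH] f /=.
  rewrite /overlap rmorph_sum; apply: eq_bigr => e _ /=.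
  by rewrite scale_polyC mulrC.
rewrite !IH -[X in _ + _ * X](reindex_ksets k (tperm p.1 p.2)).
rewrite !mulr_sumr -big_split scaler_sumr; apply: eq_bigr => e _ /=.
rewrite -imset_permM /pflip mulgA tperm2 mul1g -/(flip p e).
by rewrite -!scalerAr -scalerDr !scalerA mulrC.
Qed.

Lemma sum_flip_avg B (F : {perm 'I_n} -> R) :
  \sum_f flip_avg pflip B F f = \sum_f F f.
Proof.
elim: B => //= p B IH; rewrite -mulr_sumr big_split /=.
rewrite (sum_perm_mulgl (tperm p.1 p.2) (flip_avg pflip B F)) IH.
by rewrite -mulr2n -[X in _ * X]mulr_natl mulrA mulVf ?mul1r ?pnatr_eq0.
Qed.

Lemma twist_overlap_coef1 s B w u f : uniq B -> 
  (twist pflip s B (overlap k w u) f)`_1 =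
    \sum_(p <- B) s p * overlap k w (linear_part (@flip n) B p u) f.
Proof.
move=> uB; rewrite twist_overlap coef_sum.
under eq_bigr => e _ do rewrite coefZ twist_coef1 // mulr_sumr.
rewrite exchange_big; apply: eq_bigr => p _ /=; rewrite mulr_sumr.
by apply: eq_bigr => e _ /=; ring.
Qed.

Lemma size_twist_overlap s B w u f : uniq (flat B) ->
  (size (twist pflip s B (overlap k w u) f) <= k.+1)%N.
Proof.
move=> uB; rewrite twist_overlap; apply: leq_trans (size_sum _ _ _) _.
apply/bigmax_leqP => e /eqP ek; apply: leq_trans (size_scale_leq _ _) _.
by apply: leq_trans (size_twist _ _ _ uB) _; rewrite ltnS -ek count_splits.
Qed.

Lemma uniq_flat B : uniq (flat B) -> uniq B.
Proof.
elim: B => // p B IH; rewrite flat_cons /= inE negb_or => /and3P[/andP[_ h] _ /IH ->].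
by rewrite andbT; apply: contra h => /mem_flat /andP[].
Qed.

(** The value at 0 is 1, so that the square is always 1, as [twist_le_complex] demands. *)
Definition unit_sign (x : R) : R := if x < 0 then -1 else 1.

Lemma unit_signM x : unit_sign x * x = `|x|.
Proof.
by rewrite /unit_sign; case: ltrP => h; rewrite ?mulN1r ?mul1r ?(ltr0_norm h) ?(ger0_norm h).
Qed.

Lemma unit_sign_sqr x : unit_sign x * unit_sign x = 1.
Proof. by rewrite /unit_sign; case: ifP; rewrite ?mulrNN mulr1. Qed.

Lemma flip_avg_ge0 B (F : {perm 'I_n} -> R) f :
  (forall g, 0 <= F g) -> 0 <= flip_avg pflip B F f.
Proof.
by move=> F0; elim: B f => //= p B IH f; rewrite mulr_ge0 ?invr_ge0 ?addr_ge0.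
Qed.

(** With [s] the signs of the summands, the sum is the linear coefficient of a twist of degree at
    most k, which is bounded by M at the real points 2^-l. *)
Lemma linear_part_le_max B w u (M : R) f : uniq (flat B) -> (0 < k)%N ->
  (forall g, `|overlap k w u g| <= M) ->
  \sum_(p <- B) `|overlap k w (linear_part (@flip n) B p u) f| <= (extract_const k.-1)%:R * M.
Proof.
move=> uB k0 hM; set s := fun p => unit_sign (overlap k w (linear_part (@flip n) B p u) f).
have := @coef1_le R k.-1 (twist pflip s B (overlap k w u) f) 1 M.
rewrite mulr1 twist_overlap_coef1 ?uniq_flat // prednK // => /(_ (size_twist_overlap _ _ _ _ uB)).
rewrite (eq_bigr _ (fun p _ => unit_signM _)) ger0_norm ?sumr_ge0 //.
apply=> l; apply: twist_le => // [p|].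
  by rewrite /s /unit_sign; case: ifP; rewrite ?normrN normr1.
by rewrite mul1r ger0_norm ?invr_ge0 ?exprn_ge0 // invf_le1 ?exprn_gt0 // exprn_ege1 // ler1n.
Qed.

(** The same choice of signs, with the twist evaluated at the imaginary points i th / 2^l. *)
Lemma linear_part_le_avg B w u f : uniq (flat B) -> (0 < k)%N -> (0 < size B)%N ->
  \sum_(p <- B) `|overlap k w (linear_part (@flip n) B p u) f| <=
  (4 * extract_const k.-1)%:R * Num.sqrt (size B)%:R *
    flip_avg pflip B (fun g => `|overlap k w u g|) f.
Proof.
move=> uB k0 B0; set s := fun p => unit_sign (overlap k w (linear_part (@flip n) B p u) f).
set a := size B; set V := flip_avg _ _ _ _; set C := extract_const _.
have V0 : 0 <= V by apply: flip_avg_ge0.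
pose ra : R := Num.sqrt a%:R.
have ra0 : 0 < ra by rewrite sqrtr_gt0 ltr0n.
(* Then a th^2 = 1/4, so (1 + th^2)^a <= 2; dividing by th at the end produces the factor 2 sqrt
   a. *)
pose th : R := (2 * ra)^-1.
have th0 : 0 < th by rewrite invr_gt0 mulr_gt0.
pose P := twist pflip s B (overlap k w u) f.
have := @coef1_le _ k.-1 (map_poly (real_complex R) P) (0 +i* th)%C (2 * V)%:C%C.
rewrite prednK // size_map_poly => /(_ (size_twist_overlap _ _ _ _ uB)).
have node l : `|(map_poly (real_complex R) P).[(0 +i* th)%C / 2 ^+ l]| <= (2 * V)%:C%C.
  have -> : (0 +i* th)%C / 2 ^+ l = (0 +i* (th / 2 ^+ l))%C :> R[i].
    have -> : (2 ^+ l)^-1 = ((2 ^+ l)^-1 : R)%:C%C by rewrite fmorphV rmorphXn rmorph_nat.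
    by apply/eqP; rewrite eq_complex /= !mul0r !mulr0 subr0 add0r !eqxx.
  apply: le_trans (twist_le_complex _ _ _ _ _ (fun p => unit_sign_sqr _)) _.
  rewrite lecR ler_wpM2r // -/a.
  set y := 1 + _ ^+ 2; have y1 : 1 <= y by rewrite lerDl sqr_ge0.
  apply: (@le_trans _ _ (y ^+ a)).
    rewrite lerXn2r ?nnegrE ?sqrtr_ge0 ?(le_trans ler01) //.
    rewrite -[X in _ <= X](ger0_norm (le_trans ler01 y1)) -sqrtr_sqr ler_wsqrtr //.
    by rewrite expr2 ler_peMr // (le_trans ler01).
  apply: exp_one_plus_le; first exact: sqr_ge0.
  have -> : 4^-1 = a%:R * th ^+ 2 :> R.
    rewrite /th exprVn exprMn sqr_sqrtr // invfM mulrCA divff ?pnatr_eq0 -?lt0n //.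
    by rewrite mulr1 -natrX.
  rewrite ler_wpM2l // lerXn2r ?nnegrE ?divr_ge0 ?exprn_ge0 ?(ltW th0) //.
  by rewrite ler_pdivrMr ?exprn_gt0 // ler_peMr ?(ltW th0) // exprn_ege1 // ler1n.
move=> /(_ node); rewrite coef_map /= twist_overlap_coef1 ?uniq_flat //.
rewrite (eq_bigr _ (fun p _ => unit_signM _)); set S := \sum_(p <- B) _.
have S0 : 0 <= S by apply: sumr_ge0.
have -> : `|S%:C%C * (0 +i* th)%C| = (S * th)%:C%C.
  rewrite normrM !normc_def /= expr0n addr0 add0r !sqrtr_sqr -rmorphM.
  by rewrite (ger0_norm S0) (gtr0_norm th0).
rewrite -(rmorph_nat (real_complex R)) -rmorphM lecR -ler_pdivlMr //.
rewrite /th invrK natrM -/ra => h; apply: le_trans h _.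
by rewrite (_ : C%:R * (2 * V) * (2 * ra) = 4%:R * C%:R * ra * V) //; ring.
Qed.

Lemma linear_part_overlap_norm B w u : uniq (flat B) -> (0 < k)%N -> (0 < size B)%N ->
  \sum_(p <- B) overlap_norm k w (linear_part (@flip n) B p u) <=
  (4 * extract_const k.-1)%:R * Num.sqrt (size B)%:R * overlap_norm k w u.
Proof.
move=> uB k0 B0; rewrite /overlap_norm exchange_big /=.
rewrite -[X in _ <= _ * X](sum_flip_avg B) mulr_sumr.
by apply: ler_sum => f _; apply: linear_part_le_avg.
Qed.

End Block.

(** * Iteration over blocks *)

Section Iterate.
Variables (R : realType) (n k : nat).
Implicit Types (w u : {set 'I_n} -> R) (e : {set 'I_n}).
Implicit Types (q r B : seq ('I_n * 'I_n)) (Bs : seq (seq ('I_n * 'I_n))).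
Local Notation pair_sign := (@pair_sign R n).
Local Notation flip := (@flip n).
Local Notation blockC := (4 * extract_const k.-1)%N.

Lemma eq_dotp u v (x : {set 'I_n} -> R) : u =1 v -> dotp k u x = dotp k v x.
Proof. by move=> h; apply: eq_bigr => e _; rewrite h. Qed.

Lemma dotp_flip u (x : {set 'I_n} -> R) (c : R) p : (forall e, x (flip p e) = c * x e) ->
  dotp k (fun e => u (flip p e)) x = c * dotp k u x.
Proof.
move=> h; rewrite /dotp mulr_sumr -[RHS](reindex_ksets k (tperm p.1 p.2)).
have cc e : x e = c * x (flip p e) by rewrite -h flipK.
by apply: eq_bigr => e _; rewrite -/(flip p e) [x e]cc mulrCA.
Qed.

Lemma dotp_half u v (x : {set 'I_n} -> R) (b : R) :
  dotp k (fun e => 2^-1 * (u e + b * v e)) x = 2^-1 * (dotp k u x + b * dotp k v x).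
Proof.
by rewrite /dotp mulr_sumr -big_split mulr_sumr; apply: eq_bigr => e _ /=; ring.
Qed.

Lemma dotp_flip_avg B u (x : {set 'I_n} -> R) :
  (forall p, p \in B -> forall e, x (flip p e) = x e) ->
  dotp k (flip_avg flip B u) x = dotp k u x.
Proof.
elim: B => // p B IH h; have {}IH : dotp k (flip_avg flip B u) x = dotp k u x.
  by apply: IH => r rB; apply: h; rewrite inE rB orbT.
have fl : dotp k (fun e => flip_avg flip B u (flip p e)) x = 1 * dotp k (flip_avg flip B u) x.
  by apply: dotp_flip => e; rewrite h ?mem_head // mul1r.
rewrite (@eq_dotp _ (fun e => 2^-1 * (flip_avg flip B u e + 1 * flip_avg flip B u (flip p e)))).
  by rewrite dotp_half fl IH; lra.
by move=> e /=; rewrite mul1r.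
Qed.

(** Flips are self-adjoint. Averaging under a flip that fixes [x], and taking the half-difference
    under the one that negates [x], leave the inner product with [x] unchanged. *)
Lemma dotp_linear_part B (r : 'I_n * 'I_n) u (x : {set 'I_n} -> R) : uniq B -> r \in B ->
  (forall e, x (flip r e) = - x e) ->
  (forall p, p \in B -> p != r -> forall e, x (flip p e) = x e) ->
  dotp k (linear_part flip B r u) x = dotp k u x.
Proof.
move=> + + hr; elim: B => // p B IH /andP[pB uB]; rewrite inE /= => rB h.
have [rp | nrp] := eqVneq r p.
  have fl : dotp k (fun e => flip_avg flip B u (flip p e)) x = -1 * dotp k (flip_avg flip B u) x.
    by apply: dotp_flip => e; rewrite -rp hr mulN1r.
  rewrite (@eq_dotp _ (fun e => 2^-1 * (flip_avg flip B u e + -1 * flip_avg flip B u (flip p e)))).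
    rewrite dotp_half fl dotp_flip_avg ?mulN1r ?opprK; first by lra.
    move=> p' p'B; apply: h; first by rewrite inE p'B orbT.
    by apply: contra pB => /eqP pr; rewrite -rp -pr.
  by move=> e; rewrite mulN1r.
have {}rB : r \in B by case/orP: rB nrp => // /eqP->; rewrite eqxx.
have fl : dotp k (fun e => linear_part flip B r u (flip p e)) x =
    1 * dotp k (linear_part flip B r u) x.
  by apply: dotp_flip => e; rewrite h ?mem_head 1?eq_sym // mul1r.
rewrite (@eq_dotp _ (fun e => 
    2^-1 * (linear_part flip B r u e + 1 * linear_part flip B r u (flip p e)))).
  rewrite dotp_half fl IH //; first by lra.
  by move=> p' p'B; apply: h; rewrite inE p'B orbT.
by move=> e; rewrite mul1r.
Qed.

(** One pair is chosen from each block; [q] accumulates the pairs already chosen, which lets the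
    induction treat one block at a time. *)
Fixpoint choice_sum (f : seq ('I_n * 'I_n) -> R) Bs q : R :=
  if Bs is B :: Bs' then \sum_(p <- B) choice_sum f Bs' (p :: q) else f q.

Lemma eq_choice_sum f g Bs q :
  (forall r, {subset r <= flatten Bs} -> f (r ++ q) = g (r ++ q)) ->
  choice_sum f Bs q = choice_sum g Bs q.
Proof.
elim: Bs q => [|B Bs IH] q h /=; first exact: (h [::]).
apply: eq_big_seq => p pB; apply: IH => r hr; rewrite -cat_rcons; apply: h.
move=> z; rewrite mem_rcons inE /= mem_cat => /orP[/eqP->|/hr ->].
  by rewrite pB.
by rewrite orbT.
Qed.

Lemma perm_choose B Bs q p : p \in B ->
  perm_eq (flatten (B :: Bs) ++ q) (rem p B ++ (flatten Bs ++ p :: q)).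
Proof.
move=> pB; rewrite /= -catA perm_sym.
rewrite (perm_catl _ (_ : perm_eq _ (p :: flatten Bs ++ q))); last first.
  by rewrite perm_catC /= perm_cons perm_catC.
rewrite (perm_trans (_ : perm_eq _ ((p :: rem p B) ++ flatten Bs ++ q))) //.
  by rewrite /= perm_sym -cat1s perm_catCA.
by rewrite perm_cat2r perm_sym perm_to_rem.
Qed.

Lemma uniq_choose B Bs q p : p \in B -> uniq (flat (flatten (B :: Bs) ++ q)) ->
  uniq (flat (flatten Bs ++ p :: q)).
Proof.
move=> pB; rewrite (perm_uniq (perm_flat (perm_choose Bs q pB))).
by rewrite [flat (rem p B ++ _)]flat_cat cat_uniq => /and3P[].
Qed.

Lemma choice_sum_const f (x : R) a Bs q : uniq (flat (flatten Bs ++ q)) ->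
  all (fun B => size B == a) Bs ->
  (forall r, uniq (flat r) -> size r = (size Bs + size q)%N -> f r = x) ->
  choice_sum f Bs q = a%:R ^+ size Bs * x.
Proof.
elim: Bs q => [|B Bs IH] q uq /= => [_ h|/andP[/eqP Ba Bsa] h].
  by rewrite expr0 mul1r; apply: h.
rewrite (eq_big_seq (fun=> a%:R ^+ size Bs * x)).
  by rewrite big_const_seq count_predT Ba iter_addr_0 -[LHS]mulr_natl exprS mulrA.
move=> p pB; apply: IH => //; first exact: uniq_choose uq.
by move=> r ur sr; apply: h; rewrite // sr /= addnS.
Qed.

(** Once [p] is chosen from [B], every resulting sign function is odd under [p] and, by
    disjointness, even under the other pairs of [B], so [dotp_linear_part] applies. *)
Lemma choice_sum_linear_part u B Bs q p : p \in B -> uniq (flat (flatten (B :: Bs) ++ q)) ->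
  choice_sum (fun r => `|dotp k (linear_part flip B p u) (pair_sign r)|) Bs (p :: q) =
  choice_sum (fun r => `|dotp k u (pair_sign r)|) Bs (p :: q).
Proof.
move=> pB uq; apply: eq_choice_sum => r hr; congr `|_|.
have uB : uniq (flat B).
  by move: uq; rewrite /= -catA flat_cat cat_uniq => /and3P[].
have dis p' x : p' \in B -> x \in flat (flatten Bs ++ q) -> (x != p'.1) && (x != p'.2).
  move=> p'B xB; move: uq; rewrite /= -catA flat_cat cat_uniq => /and3P[_ /hasPn /(_ x xB) h _].
  have /andP[h1 h2] := mem_flat p'B.
  by apply/andP; split; apply: contraNneq h => ->.
have disp p' : p' \in B -> (p'.1 \notin flat (r ++ q)) /\ (p'.2 \notin flat (r ++ q)).
  move=> p'B; have sub : {subset flat (r ++ q) <= flat (flatten Bs ++ q)}.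
    move=> x /flatP [z zr /orP[] /eqP ->]; have /mem_flat/andP[] // : z \in flatten Bs ++ q;
    by move: zr; rewrite !mem_cat => /orP[/hr|] ->; rewrite ?orbT.
  by split; apply/negP => /sub /(dis _ _ p'B); rewrite eqxx ?andbF.
have pe e : pair_sign (r ++ p :: q) e = ((p.1 \in e)%:R - (p.2 \in e)%:R) * pair_sign (r ++ q) e.
  by rewrite -pair_sign_cons; apply: perm_pair_sign; rewrite -cat1s perm_catCA.
have fixd p' e : p' \in B -> pair_sign (r ++ q) (flip p' e) = pair_sign (r ++ q) e.
  by move=> /disp [h1 h2]; apply: pair_sign_fix; apply: tperm_notin.
apply: dotp_linear_part => //; first exact: uniq_flat.
  by move=> e; rewrite !pe fixd // !mem_flip tpermL tpermR -mulNr opprB.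
move=> p' p'B ne e; rewrite !pe fixd // !mem_flip.
have uBp : uniq (flat (p' :: p :: rem p (rem p' B))).
  rewrite (perm_uniq (_ : perm_eq _ (flat B))) //; apply: perm_flat.
  rewrite perm_sym (perm_trans (perm_to_rem p'B)) // perm_cons perm_to_rem //.
  by rewrite mem_rem_uniq ?uniq_flat // inE eq_sym ne.
move: uBp; rewrite !flat_cons /= !inE !negb_or.
by move=> /and3P[/and4P[_ h1 h2 _] /and3P[h3 h4 _] _]; rewrite !tpermD.
Qed.

(** Each block is spent on [linear_part_overlap_norm] at a cost of order sqrt a; when none is left,
    [overlap_norm_ge_dotp] concludes. *)
Lemma overlap_norm_iterate w u (S : R) a i Bs q : uniq (flat (flatten Bs ++ q)) ->
  all (fun B => size B == a) Bs -> (0 < a)%N -> (0 < k)%N ->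
  (size Bs + size q)%N = i -> (i <= k)%N -> 0 <= S ->
  (forall r, uniq (flat r) -> size r = i -> overlap_norm k w (pair_sign r) = S) ->
  choice_sum (fun r => `|dotp k u (pair_sign r)|) Bs q * S <=
  (4 ^ i * n ^ (k - i))%:R * (blockC%:R * Num.sqrt a%:R) ^+ size Bs * overlap_norm k w u.
Proof.
move=> uq Bsa a0 k0 Bsi ik S0 hS; elim: Bs u q uq Bsa Bsi => [|B Bs IH] u q uq.
  move=> _ /= qi; rewrite expr0 mulr1 -qi -(hS q) //.
  by apply: overlap_norm_ge_dotp; rewrite // -/(size q) -[size q]add0n qi.
move=> /= /andP[/eqP Ba Bsa] Bsi; rewrite mulr_suml.
set T := _%:R; set c := _ * Num.sqrt _.
apply: (@le_trans _ _ (\sum_(p <- B) T * c ^+ size Bs * overlap_norm k w (linear_part flip B p u))).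
  rewrite !big_seq; apply: ler_sum => p pB.
  rewrite -(choice_sum_linear_part u pB uq); apply: IH => //; first exact: uniq_choose uq.
  by rewrite /= addnS.
rewrite -mulr_sumr exprSr -!mulrA ler_wpM2l // ler_wpM2l ?exprn_ge0 ?mulr_ge0 ?sqrtr_ge0 //.
rewrite mulrA -Ba; apply: linear_part_overlap_norm => //; last by rewrite Ba.
by move: uq; rewrite /= -catA flat_cat cat_uniq => /and3P[].
Qed.

(** The first block is spent on the maximum bound, which costs no sqrt a; the other blocks go
    through [overlap_norm_iterate]. *)
Lemma overlap_max_iterate w u (S M : R) a i B Bs : uniq (flat (flatten (B :: Bs))) ->
  all (fun B => size B == a) (B :: Bs) -> (0 < a)%N -> (0 < k)%N ->
  (size Bs).+1 = i -> (i <= k)%N -> 0 <= S ->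
  (forall r, uniq (flat r) -> size r = i -> overlap_norm k w (pair_sign r) = S) ->
  (forall f, `|overlap k w u f| <= M) ->
  choice_sum (fun r => `|dotp k u (pair_sign r)|) (B :: Bs) [::] * S <=
  (4 ^ i * n ^ (k - i))%:R * (blockC%:R * Num.sqrt a%:R) ^+ size Bs *
   ((n`!)%:R * ((extract_const k.-1)%:R * M)).
Proof.
move=> uq /= /andP[/eqP Ba Bsa] a0 k0 Bsi ik S0 hS hM; rewrite mulr_suml.
set T := (4 ^ i * _)%:R; set c := _ * Num.sqrt _.
have uq0 : uniq (flat (flatten (B :: Bs) ++ [::])) by rewrite cats0.
apply: (@le_trans _ _ (\sum_(p <- B) T * c ^+ size Bs * overlap_norm k w (linear_part flip B p u))).
  rewrite !big_seq; apply: ler_sum => p pB.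
  rewrite -(choice_sum_linear_part u pB uq0); apply: overlap_norm_iterate => //.
    exact: uniq_choose uq0.
  by rewrite /= addn1.
rewrite -mulr_sumr ler_wpM2l ?mulr_ge0 ?exprn_ge0 ?mulr_ge0 ?sqrtr_ge0 //.
rewrite /overlap_norm exchange_big /= mulr_natl -card_Sn -sumr_const.
rewrite [X in _ <= X](eq_bigl predT); last by move=> f; rewrite inE.
apply: ler_sum => f _; apply: linear_part_le_max => //.
by move: uq; rewrite /= flat_cat cat_uniq => /and3P[].
Qed.

(** The inner product of [translate u g] with a sign function is the overlap of [u] with it at [g],
    so summing over [g] gives an overlap norm. *)
Lemma sum_choice_translate u (Bs : seq (seq ('I_n * 'I_n))) q :
  \sum_g choice_sum (fun r => `|dotp k (translate u g) (pair_sign r)|) Bs q =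
  choice_sum (fun r => overlap_norm k u (pair_sign r)) Bs q.
Proof.
elim: Bs q => [|B Bs IH] q /=.
  apply: eq_bigr => g _; congr `|_|; apply: eq_bigr => e _; exact: mulrC.
by rewrite exchange_big; apply: eq_bigr.
Qed.

(** Apply the iteration to every translate of [u], which has the same overlap norm with [w], and
    sum; the inner products with [u] then add up to [Su] for each choice of pairs. *)
Lemma overlap_norm_lower w u (Sw Su : R) a i Bs : uniq (flat (flatten Bs)) ->
  all (fun B => size B == a) Bs -> (0 < a)%N -> (0 < k)%N ->
  size Bs = i -> (i <= k)%N ->
  (forall r, uniq (flat r) -> size r = i -> overlap_norm k w (pair_sign r) = Sw) ->
  (forall r, uniq (flat r) -> size r = i -> overlap_norm k u (pair_sign r) = Su) -> 0 <= Sw ->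
  a%:R ^+ i * (Sw * Su) <= (n`!)%:R *
   ((4 ^ i * n ^ (k - i))%:R * (blockC%:R * Num.sqrt a%:R) ^+ i * overlap_norm k w u).
Proof.
move=> uq Bsa a0 k0 Bsi ik hw hu Sw0.
have uq0 : uniq (flat (flatten Bs ++ [::])) by rewrite cats0.
have -> : a%:R ^+ i * (Sw * Su) =
   (\sum_g choice_sum (fun r => `|dotp k (translate u g) (pair_sign r)|) Bs [::]) * Sw.
  rewrite sum_choice_translate (@choice_sum_const _ Su a) //; first by rewrite Bsi; ring.
  by move=> r ur; rewrite addn0 Bsi; apply: hu.
rewrite mulr_suml mulr_natl -card_Sn -sumr_const.
rewrite [X in _ <= X](eq_bigl predT); last by move=> f; rewrite inE.
apply: ler_sum => g _.
rewrite -[X in _ * _ ^+ X * _]Bsi -(overlap_norm_translate k w u g).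
by apply: overlap_norm_iterate => //; rewrite addn0.
Qed.

Lemma overlap_max_lower w u (Sw Su M : R) a i Bs : uniq (flat (flatten Bs)) ->
  all (fun B => size B == a) Bs -> (0 < a)%N -> (0 < k)%N ->
  size Bs = i.+1 -> (i.+1 <= k)%N ->
  (forall r, uniq (flat r) -> size r = i.+1 -> overlap_norm k w (pair_sign r) = Sw) ->
  (forall r, uniq (flat r) -> size r = i.+1 -> overlap_norm k u (pair_sign r) = Su) -> 0 <= Sw ->
  (forall f, `|overlap k w u f| <= M) ->
  a%:R ^+ i.+1 * (Sw * Su) <= (n`!)%:R *
   ((4 ^ i.+1 * n ^ (k - i.+1))%:R * (blockC%:R * Num.sqrt a%:R) ^+ i *
   ((n`!)%:R * ((extract_const k.-1)%:R * M))).
Proof.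
move=> uq Bsa a0 k0 Bsi ik hw hu Sw0 hM.
have uq0 : uniq (flat (flatten Bs ++ [::])) by rewrite cats0.
have -> : a%:R ^+ i.+1 * (Sw * Su) =
   (\sum_g choice_sum (fun r => `|dotp k (translate u g) (pair_sign r)|) Bs [::]) * Sw.
  rewrite sum_choice_translate (@choice_sum_const _ Su a) //; first by rewrite Bsi; ring.
  by move=> r ur; rewrite addn0 Bsi; apply: hu.
rewrite mulr_suml [X in _ <= X]mulr_natl -[X in _ <= _ *+ X]card_Sn -sumr_const.
rewrite [X in _ <= X](eq_bigl predT); last by move=> f; rewrite inE.
case: Bs uq Bsa Bsi uq0 => // B Bs uq Bsa [Bsi] _; subst i.
apply: ler_sum => g _; apply: (@overlap_max_iterate w) => // f.
by rewrite overlap_translate.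
Qed.

End Iterate.

(** * Assembling the estimates into the two bounds *)

(** Here s = sqrt a, t = sqrt n and N = n!; [W] and [U] are the norms. The case m = 0 serves the
    mean and m = 1 the maximum, with [E] the quantity bounded below. *)
Lemma assemble_bounds (R : realFieldType) (k i m : nat)
    (s t c K E W U Sw Su N : R) :
  0 < s -> 0 < t -> t <= 2 * k%:R * s -> (0 < k)%N -> 1 <= c -> 0 < K -> 0 < N ->
  0 <= E -> 0 <= W -> 0 <= U -> 0 <= Sw -> 0 <= Su -> (i <= k)%N -> (m <= 1)%N ->
  N * W <= K * (t ^+ 2) ^+ i * Sw -> N * U <= K * (t ^+ 2) ^+ i * Su ->
  s ^+ m * ((s ^+ 2) ^+ i * (Sw * Su)) <=
    N * (4 ^+ i * (t ^+ 2) ^+ (k - i) * (c * s) ^+ i * (N * E)) ->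
  W * U * t ^+ (i + m) <= (8 * k%:R * c) ^+ k.+1 * K ^+ 2 * t ^+ (2 * k + 2 * i) * E.
Proof.
move=> s0 t0 ts k0 c1 K0 N0 E0 W0 U0 Sw0 Su0 ik m1 hW hU h.
have c0 : 0 < c by apply: lt_le_trans c1.
have k1 : 1 <= k%:R :> R by rewrite ler1n.
have p x j : 0 < x -> 0 < x ^+ j :> R by move=> ?; rewrite exprn_gt0.
(* Multiply the two level inequalities and insert the last hypothesis; N^2 and the s^i coming from
   (c s)^i cancel. *)
have h1 : s ^+ (i + m) * (W * U) <=
    K ^+ 2 * t ^+ (2 * k + 2 * i) * (4 * c) ^+ i * E.
  have Z : 0 < N ^+ 2 * s ^+ i by rewrite mulr_gt0 // p.
  rewrite -(ler_pM2l Z).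
  have e1 : N ^+ 2 * s ^+ i * (s ^+ (i + m) * (W * U)) =
     s ^+ m * (s ^+ 2) ^+ i * ((N * W) * (N * U)).
    by rewrite exprD -!exprM mulnC exprM; ring.
  have e2 : s ^+ m * (s ^+ 2) ^+ i * (K * (t ^+ 2) ^+ i * Sw * (K * (t ^+ 2) ^+ i * Su))
     = K ^+ 2 * ((t ^+ 2) ^+ i) ^+ 2 * (s ^+ m * ((s ^+ 2) ^+ i * (Sw * Su))).
    by ring.
  have e3 : N ^+ 2 * s ^+ i * (K ^+ 2 * t ^+ (2 * k + 2 * i) * (4 * c) ^+ i * E) =
    K ^+ 2 * ((t ^+ 2) ^+ i) ^+ 2 *
      (N * (4 ^+ i * (t ^+ 2) ^+ (k - i) * (c * s) ^+ i * (N * E))).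
    have -> : t ^+ (2 * k + 2 * i) = ((t ^+ 2) ^+ i) ^+ 2 * (t ^+ 2) ^+ (k - i).
      by rewrite -!exprM -exprD; congr (_ ^+ _); clear -ik; lia.
    by rewrite !exprMn; ring.
  rewrite e1 e3; apply: (@le_trans _ _ (s ^+ m * (s ^+ 2) ^+ i *
      (K * (t ^+ 2) ^+ i * Sw * (K * (t ^+ 2) ^+ i * Su)))).
    apply: ler_wpM2l; first by rewrite mulr_ge0 ?exprn_ge0 // ltW.
    by apply: ler_pM; rewrite // mulr_ge0 // ltW.
  by rewrite e2 ler_wpM2l // mulr_ge0 ?exprn_ge0 // ltW.
have h2 : t ^+ (i + m) <= (2 * k%:R) ^+ (i + m) * s ^+ (i + m).
  by rewrite -exprMn lerXn2r // nnegrE ?(ltW t0) // !mulr_ge0 // ltW.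
apply: (@le_trans _ _ ((2 * k%:R) ^+ (i + m) * (s ^+ (i + m) * (W * U)))).
  by rewrite mulrA [X in _ <= X]mulrC ler_wpM2l ?mulr_ge0.
apply: (@le_trans _ _ ((2 * k%:R) ^+ (i + m) *
    (K ^+ 2 * t ^+ (2 * k + 2 * i) * (4 * c) ^+ i * E))).
  by rewrite ler_wpM2l // exprn_ge0 // mulr_ge0.
have -> : (2 * k%:R) ^+ (i + m) * (K ^+ 2 * t ^+ (2 * k + 2 * i) * (4 * c) ^+ i * E)
   = (2 * k%:R) ^+ (i + m) * (4 * c) ^+ i * (K ^+ 2 * t ^+ (2 * k + 2 * i) * E) by ring.
rewrite -!(mulrA (_ ^+ k.+1)) ler_wpM2r ?mulr_ge0 ?exprn_ge0 ?(ltW t0) ?(ltW K0) //.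
(* Equalizing the exponents merges the bases into 8 k c >= 1, whose exponent i + m is at most k +
   1. *)
apply: (@le_trans _ _ ((2 * k%:R) ^+ (i + m) * (4 * c) ^+ (i + m))).
  by rewrite ler_wpM2l ?exprn_ge0 ?mulr_ge0 // ler_weXn2l ?leq_addr //; clear -c1; lra.
rewrite -exprMn (_ : 2 * k%:R * (4 * c) = 8 * k%:R * c); last by ring.
have kc : 1 <= k%:R * c by apply: mulr_ege1.
have im : (i + m <= k.+1)%N.
  by rewrite -addn1 leq_add.
by rewrite ler_weXn2l // -mulrA; clear -kc; lra.
Qed.

Lemma dotp_wperm (R : realType) n k (w u : {set 'I_n} -> R) f :
  dotp k (wperm f w) u = overlap k w u f^-1%g.
Proof. by apply: eq_bigr => e _; rewrite mulrC. Qed.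

Lemma disc_ge_overlap (R : realType) n k (w u : {set 'I_n} -> R) f :
  wsum k w [set: 'I_n] = 0 -> `|overlap k w u f| <= disc k w u.
Proof.
move=> w0; rewrite /disc /dens w0 !mul0r.
apply: le_trans (le_bigmax _ _ f^-1%g).
by rewrite subr0 dotp_wperm invgK.
Qed.

Lemma exp_abs_dotE (R : realType) n k (w u : {set 'I_n} -> R) :
  exp_abs_dot k w u = (n`!)%:R^-1 * overlap_norm k w u.
Proof.
rewrite /exp_abs_dot /overlap_norm; congr (_ * _).
rewrite [RHS](reindex_inj invg_inj) /=.
by apply: eq_bigr => f _; rewrite dotp_wperm.
Qed.

(* Part index j : 'I_k corresponds to i = j+1 in the paper.
   n^{i/2-1/2+k} = sqrt(n)^(j+2k) and n^{i/2+k} = sqrt(n)^(j+1+2k). *)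
Theorem theorem5p1 (R : realType) (k : nat) (hk : (1 <= k)%N) :
  exists c1 c2 : R, 0 < c1 /\ 0 < c2 /\
  forall (n : nat), (2 * k <= n)%N ->
  forall F : ({set 'I_n} -> R) -> Prop,
    (forall w, F w -> is_kgraph k w /\ wsum k w [set: 'I_n] = 0) ->
    exists part : ({set 'I_n} -> R) -> 'I_k,
      forall (j : 'I_k) (w u : {set 'I_n} -> R),
        F w -> F u -> part w = j -> part u = j -> w <> u ->
        c1 * hnorm1 k w * hnorm1 k u / (Num.sqrt (n%:R : R)) ^+ (j + 2 * k)%N
          <= disc k w u /\
        c2 * hnorm1 k w * hnorm1 k u / (Num.sqrt (n%:R : R)) ^+ (j.+1 + 2 * k)%N
          <= exp_abs_dot k w u.
Proof.
pose C := extract_const k.-1.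
have C0 : (0 < C)%N by rewrite muln_gt0 /= prodn_gt0.
pose K : R := 2 * (1 + k%:R ^+ 2) ^+ (2 * k).
have K0 : 0 < K by rewrite mulr_gt0 // exprn_gt0 // ltr_pwDl // exprn_ge0.
pose c : R := (4 * C)%:R.
have c1 : 1 <= c by rewrite ler1n muln_gt0.
pose Z : R := (8 * k%:R * c) ^+ k.+1 * K ^+ 2.
have Z0 : 0 < Z.
  rewrite mulr_gt0 ?exprn_gt0 // mulr_gt0 ?(lt_le_trans _ c1) // mulr_gt0 //.
  by rewrite ltr0n.
exists Z^-1, Z^-1; rewrite !invr_gt0; split=> //; split=> // n kn F hF.
have [r rk ur] : exists2 r : seq ('I_n * 'I_n), size r = k & uniq (flat r).
  have : size (take k.*2 (enum 'I_n)) = k.*2.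
    by rewrite size_takel // size_enum_ord -mul2n.
  by move=> /flat_surj [r rk fr]; exists r; rewrite // fr take_uniq // enum_uniq.
pose good w (j : 'I_k) := (n`!)%:R * hnorm1 k w <=
   K * (n%:R ^+ j.+1 * overlap_norm k w (pair_sign R (take j.+1 r))).
(* The part of [w] is a level at which [w] is large; for members of [F] one exists by
   [exists_level], so the default is never taken. *)
exists (fun w => odflt (Ordinal hk) [pick j | good w j]) => j w u Fw Fu wj uj _.
have [_ w0] := hF w Fw; have [_ u0] := hF u Fu.
have pick_good v : wsum k v [set: 'I_n] = 0 ->
    odflt (Ordinal hk) [pick j | good v j] = j -> good v j.
  move=> v0; case: pickP => [i gi /= <- //|none].
  by have [i gi] := exists_level kn ur rk v0 hk; have := none i; rewrite /good gi.
have {wj}gw := pick_good w w0 wj; have {uj}gu := pick_good u u0 uj.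
pose i := j.+1; have ik : (i <= k)%N by apply: ltn_ord.
(* At most k blocks of [a] disjoint pairs use at most 2ka <= n vertices, while n <= 4ka keeps [a] of
   order n. *)
pose a := (n %/ (2 * k))%N.
have a0 : (0 < a)%N by rewrite divn_gt0 // muln_gt0.
have an : (2 * k * a <= n)%N by rewrite mulnC leq_trunc_div.
have na : (n <= 4 * k * a)%N.
  have : (n < a.+1 * (2 * k))%N by apply: ltn_ceil; rewrite muln_gt0.
  move=> h; apply: leq_trans (ltnW h) _; rewrite mulSn -[X in (X + _ <= _)%N]mul1n.
  apply: (@leq_trans (a * (2 * k) + a * (2 * k))); first by rewrite leq_add2r leq_mul2r a0 orbT.
  by clear; lia.
have [Bs [uB Bsa Bsi]] : exists Bs : seq (seq ('I_n * 'I_n)),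
   [/\ uniq (flat (flatten Bs)), all (fun B => size B == a) Bs & size Bs = i].
  have sz : size (take (i * a).*2 (enum 'I_n)) = (i * a).*2.
    rewrite size_takel // size_enum_ord -mul2n mulnA; apply: leq_trans an.
    by rewrite leq_mul2r leq_mul2l ik !orbT.
  have [q qi fq] := flat_surj sz.
  have sq : size q = sumn (nseq i a) by rewrite qi sumn_nseq mulnC.
  exists (reshape (nseq i a) q); split.
  - by rewrite reshapeKr ?sq // fq take_uniq // enum_uniq.
  - have := reshapeKl (sh := nseq i a) (s := q); rewrite sq leqnn => /(_ isT) sh.
    by rewrite -(all_map size (pred1 a)) -/(shape _) sh all_nseq /= eqxx ?orbT.
  - by rewrite size_reshape size_nseq.
have inv v q : uniq (flat q) -> size q = i ->
    overlap_norm k v (pair_sign R q) = overlap_norm k v (pair_sign R (take i r)).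
  move=> uq qi; rewrite -!overlap_norm_mixed_sign0;
      apply: overlap_norm_mixed_sign_uniq; rewrite ?cats0 ?size_takel ?rk //.
  by move: ur; rewrite -{1}(cat_take_drop i r) flat_cat cat_uniq => /and3P[].
set Sw := overlap_norm k w (pair_sign R (take i r)).
set Su := overlap_norm k u (pair_sign R (take i r)).
have Sw0 : 0 <= Sw by apply: overlap_norm_ge0.
have Su0 : 0 <= Su by apply: overlap_norm_ge0.
pose s : R := Num.sqrt a%:R; set t : R := Num.sqrt n%:R.
have n0 : (0 < n)%N by apply: leq_trans kn; rewrite muln_gt0.
have s0 : 0 < s by rewrite sqrtr_gt0 ltr0n.
have t0 : 0 < t by rewrite sqrtr_gt0 ltr0n.
have s2 : s ^+ 2 = a%:R by rewrite sqr_sqrtr.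
have t2 : t ^+ 2 = n%:R by rewrite sqr_sqrtr.
have ts : t <= 2 * k%:R * s.
  rewrite -(@ler_pXn2r _ 2) ?nnegrE ?(ltW t0) ?mulr_ge0 ?(ltW s0) //.
  rewrite !exprMn t2 s2 -!natrX -!natrM ler_nat; apply: leq_trans na _.
  by rewrite leq_mul2r (leq_mul2l 4 k (k ^ 2)) leq_pmulr ?orbT.
have N0 : 0 < (n`!)%:R :> R by rewrite ltr0n fact_gt0.
have hW : (n`!)%:R * hnorm1 k w <= K * (t ^+ 2) ^+ i * Sw by rewrite t2 -mulrA.
have hU : (n`!)%:R * hnorm1 k u <= K * (t ^+ 2) ^+ i * Su by rewrite t2 -mulrA.
have W0 : 0 <= hnorm1 k w by apply: sumr_ge0.
have U0 : 0 <= hnorm1 k u by apply: sumr_ge0.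
have T_E : (4 ^ i * n ^ (k - i))%:R = 4 ^+ i * (t ^+ 2) ^+ (k - i) :> R.
  by rewrite natrM !natrX t2.
(* Multiplying through by t^(i+m) completes the denominator's exponent to 2k + 2i, as in
   [assemble_bounds]. *)
have finish m E : (m <= 1)%N -> 0 <= E ->
  s ^+ m * ((s ^+ 2) ^+ i * (Sw * Su)) <= (n`!)%:R *
    (4 ^+ i * (t ^+ 2) ^+ (k - i) * (c * s) ^+ i * ((n`!)%:R * E)) ->
  Z^-1 * hnorm1 k w * hnorm1 k u / t ^+ (j.+1 - m + 2 * k) <= E.
  move=> m1 E0 /(assemble_bounds s0 t0 ts hk c1 K0 N0 E0 W0 U0 Sw0 Su0 ik m1 hW hU) h.
  rewrite ler_pdivrMr ?exprn_gt0 // -mulrA mulrC ler_pdivrMr //.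
  rewrite -(ler_pM2r (exprn_gt0 (i + m) t0)); apply: le_trans h _.
  rewrite -/Z (_ : (2 * k + 2 * i = j.+1 - m + 2 * k + (i + m))%N).
    by rewrite exprD le_eqVlt; apply/orP; left; apply/eqP; ring.
  by rewrite /i; clear -m1; lia.
split.
  have := finish 1%N (disc k w u) isT; rewrite subSS subn0; apply.
    by apply: le_trans (normr_ge0 (overlap k w u 1%g)) (disc_ge_overlap _ _ w0).
  have := overlap_max_lower uB Bsa a0 hk Bsi ik (inv w) (inv u) Sw0
            (fun f => disc_ge_overlap u f w0).
  rewrite T_E -/c -/s => h; rewrite s2 expr1.
  apply: le_trans (ler_wpM2l (ltW s0) h) _.
  rewrite -/C.
  (* The maximum bound carries C (c s)^j; the extra factor s together with C <= c turns this into (c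
     s)^i with i = j + 1. *)
  pose X := (n`!)%:R * (4 ^+ i * (t ^+ 2) ^+ (k - i)) * (c * s) ^+ j * (n`!)%:R
            * disc k w u * s.
  have X0 : 0 <= X.
    rewrite !mulr_ge0 ?exprn_ge0 ?mulr_ge0 ?(ltW s0) ?(ltW t0) ?(le_trans ler01 c1) //.
    exact: le_trans (normr_ge0 (overlap k w u 1%g)) (disc_ge_overlap _ _ w0).
  rewrite [X in X <= _](_ : _ = C%:R * X); last by rewrite /X; ring.
  rewrite [X in _ <= X](_ : _ = c * X); last by rewrite /X [(c * s) ^+ i]exprS; ring.
  by rewrite ler_wpM2r // ler_nat leq_pmull.
have := finish 0%N (exp_abs_dot k w u) isT; rewrite subn0 expr0 mul1r; apply.
  by rewrite exp_abs_dotE mulr_ge0 ?invr_ge0 ?overlap_norm_ge0.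
rewrite exp_abs_dotE mulVKf ?gt_eqF // s2 -T_E.
exact: (overlap_norm_lower uB Bsa a0 hk Bsi ik (inv w) (inv u) Sw0).
Qed.
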